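(* Let $(H,R)$ be a semisimple almost-triangular Hopf algebra over a field $k$ of characteristic zero, and let $V$ be an irreducible Yetter-Drinfeld module in ${}_H^H\mathcal{YD}$. Then the dimension of $D_V$ divides the dimension of $V$.
   Context: $S$ is the antipode of $H$; Sweedler notation is used. A quasi-triangular Hopf algebra is a pair $(H,R)$, $R=R^1\otimes R^2\in H\otimes H$ invertible, with $R^1h_{(1)}\otimes R^2h_{(2)}=h_{(2)}R^1\otimes h_{(1)}R^2$, $(\Delta\otimes id)(R)=R^{13}R^{23}$, $(id\otimes\Delta)(R)=R^{13}R^{12}$. It is almost-triangular if $R^{21}R\in Z(H)\otimes Z(H)$, where $R^{21}=R^2\otimes R^1$ and $Z(H)$ is the center of $H$. ${}_H^H\mathcal{YD}$ is the category of left-left Yetter-Drinfeld modules: left $H$-modules and left $H$-comodules $V$, $v\mapsto v_{\langle-1\rangle}\otimes v_{\langle0\rangle}$, with $h_{(1)}v_{\langle-1\rangle}\otimes h_{(2)}v_{\langle0\rangle}=(h_{(1)}v)_{\langle-1\rangle}h_{(2)}\otimes(h_{(1)}v)_{\langle0\rangle}$. $H_R$ is the transmuted braided group: the algebra $H$ with left adjoint action $h\cdot_{ad}h'=h_{(1)}h'S(h_{(2)})$, coproduct $\Delta_R(h)=h_{(1)}S(R^2)\otimes R^1\cdot_{ad}h_{(2)}$ and counit $\varepsilon$. Each $V\in{}_H^H\mathcal{YD}$ is a left $H_R$-comodule via $\rho_R(v)=v_{\langle-1\rangle}S(R^2)\otimes R^1v_{\langle0\rangle}$. $D_V$ is the subcoalgebra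 of $(H,\Delta_R,\varepsilon)$ generated by $(V,\rho_R)$, i.e. the smallest subcoalgebra $D$ with $\rho_R(V)\subseteq D\otimes V$. *)

(* Defs.v *)
From HB Require Import structures.
From mathcomp Require Import all_boot all_order all_algebra.
From mathcomp Require Import generic_quotient boolp classical_sets.

Set Implicit Arguments.
Unset Strict Implicit.
Unset Printing Implicit Defensive.

Import GRing.Theory.
Local Open Scope ring_scope.
Local Open Scope classical_set_scope.
Local Open Scope quotient_scope.

(* An element of U ⊗ V is a class of finite formal sums of pairs, two formal
   sums being identified when every bilinear map takes the same value on them
   (the congruence imposed by the universal property). *)

Section TensorProduct.
Variables (k : fieldType) (U V : lmodType k).

Definition tensor_eqv (s t : seq (U * V)) : bool :=
  `[< forall (W : lmodType k) (f : {bilinear U -> V -> W}),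
      \sum_(p <- s) f p.1 p.2 = \sum_(p <- t) f p.1 p.2 >].

Lemma tensor_eqvP s t : reflect
  (forall (W : lmodType k) (f : {bilinear U -> V -> W}),
      \sum_(p <- s) f p.1 p.2 = \sum_(p <- t) f p.1 p.2) (tensor_eqv s t).
Proof. exact: asboolP. Qed.

Lemma tensor_eqv_refl : reflexive tensor_eqv.
Proof. by move=> s; apply/tensor_eqvP. Qed.

Lemma tensor_eqv_sym : symmetric tensor_eqv.
Proof.
by move=> s t; apply/tensor_eqvP/tensor_eqvP => e W f; rewrite e.
Qed.

Lemma tensor_eqv_trans : transitive tensor_eqv.
Proof.
move=> t s u /tensor_eqvP e1 /tensor_eqvP e2.
by apply/tensor_eqvP => W f; rewrite e1 e2.
Qed.

Canonical tensor_equiv :=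
  EquivRel tensor_eqv tensor_eqv_refl tensor_eqv_sym tensor_eqv_trans.

Definition tensor : Type := {eq_quot tensor_equiv}.
HB.instance Definition _ := Choice.on tensor.
HB.instance Definition _ := Quotient.on tensor.

(* A list [:: (u_1, v_1); ..; (u_n, v_n)] with t = \sum_i u_i ⊗ v_i; sums over
   it play the role of Sweedler sums, and do not depend on the chosen list as
   long as the summand is bilinear (lemma [sum_terms]). *)
Definition terms (t : tensor) : seq (U * V) := repr t.

Definition tens (u : U) (v : V) : tensor := \pi_tensor [:: (u, v)].

Lemma pi_tensor_eq s t : (\pi_tensor s = \pi_tensor t) <->
  (forall (W : lmodType k) (f : {bilinear U -> V -> W}),
      \sum_(p <- s) f p.1 p.2 = \sum_(p <- t) f p.1 p.2).
Proof.
split => [e|e]; first by apply/tensor_eqvP/eqmodP.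
by apply/eqmodP/tensor_eqvP.
Qed.

Lemma sum_terms_pi (W : lmodType k) (f : {bilinear U -> V -> W}) s :
  \sum_(p <- terms (\pi_tensor s)) f p.1 p.2 = \sum_(p <- s) f p.1 p.2.
Proof. by move: W f; apply/pi_tensor_eq; rewrite reprK. Qed.

Definition scale_terms (a : k) (s : seq (U * V)) : seq (U * V) :=
  [seq (a *: p.1, p.2) | p <- s].

Definition tensor_zero : tensor := \pi_tensor [::].
Definition tensor_add (x y : tensor) : tensor :=
  \pi_tensor (terms x ++ terms y).
Definition tensor_scale (a : k) (x : tensor) : tensor :=
  \pi_tensor (scale_terms a (terms x)).
Definition tensor_opp (x : tensor) : tensor := tensor_scale (-1) x.

Lemma sum_scale_terms (W : lmodType k) (f : {bilinear U -> V -> W}) a s :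
  \sum_(p <- scale_terms a s) f p.1 p.2 = a *: \sum_(p <- s) f p.1 p.2.
Proof.
by rewrite big_map scaler_sumr; apply: eq_bigr => p _ /=; rewrite linearZl_LR.
Qed.

Lemma tensor_ext (x y : tensor) :
  (forall (W : lmodType k) (f : {bilinear U -> V -> W}),
    \sum_(p <- terms x) f p.1 p.2 = \sum_(p <- terms y) f p.1 p.2) -> x = y.
Proof. by move=> /pi_tensor_eq; rewrite !reprK. Qed.

Let sum_add (W : lmodType k) (f : {bilinear U -> V -> W}) x y :
  \sum_(p <- terms (tensor_add x y)) f p.1 p.2 =
  \sum_(p <- terms x) f p.1 p.2 + \sum_(p <- terms y) f p.1 p.2.
Proof. by rewrite sum_terms_pi big_cat. Qed.

Let sum_scale (W : lmodType k) (f : {bilinear U -> V -> W}) a x :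
  \sum_(p <- terms (tensor_scale a x)) f p.1 p.2 =
  a *: \sum_(p <- terms x) f p.1 p.2.
Proof. by rewrite sum_terms_pi sum_scale_terms. Qed.

Let sum_zero (W : lmodType k) (f : {bilinear U -> V -> W}) :
  \sum_(p <- terms tensor_zero) f p.1 p.2 = 0.
Proof. by rewrite sum_terms_pi big_nil. Qed.

Lemma tensor_addA : associative tensor_add.
Proof. by move=> x y z; apply: tensor_ext => W f; rewrite !sum_add addrA. Qed.

Lemma tensor_addC : commutative tensor_add.
Proof. by move=> x y; apply: tensor_ext => W f; rewrite !sum_add addrC. Qed.

Lemma tensor_add0 : left_id tensor_zero tensor_add.
Proof.
by move=> x; apply: tensor_ext => W f; rewrite sum_add sum_zero add0r.
Qed.

Lemma tensor_addN : left_inverse tensor_zero tensor_opp tensor_add.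
Proof.
move=> x; apply: tensor_ext => W f.
by rewrite sum_add sum_scale sum_zero scaleN1r addNr.
Qed.

HB.instance Definition _ := GRing.isZmodule.Build tensor
  tensor_addA tensor_addC tensor_add0 tensor_addN.

Lemma tensor_scaleA a b x :
  tensor_scale a (tensor_scale b x) = tensor_scale (a * b) x.
Proof. by apply: tensor_ext => W f; rewrite !sum_scale scalerA. Qed.

Lemma tensor_scale1 : left_id 1 tensor_scale.
Proof. by move=> x; apply: tensor_ext => W f; rewrite sum_scale scale1r. Qed.

Lemma tensor_scaleDr : right_distributive tensor_scale +%R.
Proof.
move=> a x y; apply: tensor_ext => W f.
by rewrite sum_scale !sum_add !sum_scale scalerDr.
Qed.

Lemma tensor_scaleDl x : {morph tensor_scale^~ x : a b / a + b}.
Proof.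
move=> a b; apply: tensor_ext => W f.
by rewrite sum_scale sum_add !sum_scale scalerDl.
Qed.

HB.instance Definition _ := GRing.Zmodule_isLmodule.Build k tensor
  tensor_scaleA tensor_scale1 tensor_scaleDr tensor_scaleDl.

Lemma tens_is_bilinear : bilinear_for *:%R *:%R tens.
Proof.
split=> [v a u1 u2|u a v1 v2]; apply: tensor_ext => W f /=;
  rewrite sum_add sum_scale !sum_terms_pi !big_seq1 /=.
- by rewrite linearPl.
- by rewrite linearPr.
Qed.

HB.instance Definition _ := bilinear_isBilinear.Build k U V tensor
  *:%R *:%R tens tens_is_bilinear.

Lemma sum_terms_is_linear (W : lmodType k) (f : {bilinear U -> V -> W}) :
  linear (fun t => \sum_(p <- terms t) f p.1 p.2).
Proof. by move=> a x y; rewrite sum_add sum_scale. Qed.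

Lemma sum_terms_tens (W : lmodType k) (f : {bilinear U -> V -> W}) u v :
  \sum_(p <- terms (tens u v)) f p.1 p.2 = f u v.
Proof. by rewrite sum_terms_pi big_seq1. Qed.

Lemma tens_terms (t : tensor) : \sum_(p <- terms t) tens p.1 p.2 = t.
Proof.
apply: tensor_ext => W f.
pose F t := \sum_(p <- terms t) f p.1 p.2.
have FD x y : F (x + y) = F x + F y by exact: sum_add.
have F0 : F 0 = 0 by exact: sum_zero.
rewrite -!/(F _) (big_morph F FD F0).
by apply: eq_bigr => p _; rewrite /F sum_terms_tens.
Qed.

Lemma sum_terms (W : lmodType k) (f : {bilinear U -> V -> W}) s t :
  \sum_(p <- s) tens p.1 p.2 = t ->
  \sum_(p <- terms t) f p.1 p.2 = \sum_(p <- s) f p.1 p.2.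
Proof.
move=> <-; pose F t := \sum_(p <- terms t) f p.1 p.2.
have FD x y : F (x + y) = F x + F y by exact: sum_add.
have F0 : F 0 = 0 by exact: sum_zero.
rewrite -!/(F _) (big_morph F FD F0).
by apply: eq_bigr => p _; rewrite /F sum_terms_tens.
Qed.

End TensorProduct.

Notation "U ⊗ V" := (tensor U V) (at level 38, right associativity) : type_scope.
Notation "u ⊗ v" := (tens u v) (at level 38, right associativity) : ring_scope.

(* The subspace A ⊗ B of U ⊗ V, i.e. the image of the canonical map. *)
Definition tensor_of (k : fieldType) (U V : lmodType k)
    (A : set U) (B : set V) : set (U ⊗ V) :=
  [set t | exists2 s : seq (U * V),
     (forall p, p \in s -> A p.1 /\ B p.2) & t = \sum_(p <- s) p.1 ⊗ p.2].

Definition tmul (k : fieldType) (A B : algType k) (x y : A ⊗ B) : A ⊗ B :=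
  \sum_(p <- terms x) \sum_(q <- terms y) (p.1 * q.1) ⊗ (p.2 * q.2).

Definition subspace (k : fieldType) (V : lmodType k) (A : set V) : Prop :=
  A 0 /\ forall (a : k) x y, A x -> A y -> A (a *: x + y).

Definition has_dim (k : fieldType) (V : lmodType k) (A : set V) (n : nat) :=
  exists e : 'I_n -> V,
    (forall c : 'I_n -> k, \sum_i c i *: e i = 0 -> forall i, c i = 0) /\
    (forall v, A v <-> exists c : 'I_n -> k, v = \sum_i c i *: e i).

HB.mixin Record Algebra_isHopf (k : fieldType) H of GRing.Algebra k H := {
  comul : {linear H -> ((H : lmodType k) ⊗ (H : lmodType k))%type};
  counit : {lrmorphism H -> k | *%R};
  antipode : {linear H -> H};
  comul1 : comul 1 = 1 ⊗ 1;
  comulM : forall x y : H, comul (x * y) = tmul (comul x) (comul y);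
  comulA : forall x : H,
    \sum_(p <- terms (comul x)) \sum_(q <- terms (comul p.2))
      p.1 ⊗ (q.1 ⊗ q.2) =
    \sum_(p <- terms (comul x)) \sum_(q <- terms (comul p.1))
      q.1 ⊗ (q.2 ⊗ p.2);
  counitl : forall x : H, \sum_(p <- terms (comul x)) counit p.1 *: p.2 = x;
  counitr : forall x : H, \sum_(p <- terms (comul x)) counit p.2 *: p.1 = x;
  antipodel : forall x : H,
    \sum_(p <- terms (comul x)) antipode p.1 * p.2 = counit x *: 1;
  antipoder : forall x : H,
    \sum_(p <- terms (comul x)) p.1 * antipode p.2 = counit x *: 1;
}.

#[short(type="hopfAlgType")]
HB.structure Definition HopfAlgebra (k : fieldType) :=
  { H of GRing.Algebra k H & Algebra_isHopf k H }.

Section HopfTheory.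
Variables (k : fieldType) (H : hopfAlgType k).
Local Notation S := (antipode : H -> H).
Local Notation Δ := (comul : H -> H ⊗ H).

Definition left_ideal (I : set H) : Prop :=
  subspace I /\ forall h x, I x -> I (h * x).

(* H is semisimple as an algebra: the left regular module is completely
   reducible. *)
Definition semisimple_alg : Prop :=
  forall I, left_ideal I -> exists J, [/\ left_ideal J,
    I `&` J = [set 0] & forall h, exists x y, [/\ I x, J y & h = x + y]].

Definition center : set H := [set z | forall h, z * h = h * z].

Definition quasi_triangular (R : H ⊗ H) : Prop :=
  [/\ exists Q, tmul R Q = 1 ⊗ 1 /\ tmul Q R = 1 ⊗ 1,
      forall h,
        \sum_(r <- terms R) \sum_(p <- terms (Δ h)) (r.1 * p.1) ⊗ (r.2 * p.2) =
        \sum_(r <- terms R) \sum_(p <- terms (Δ h)) (p.2 * r.1) ⊗ (p.1 * r.2),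
      \sum_(r <- terms R) \sum_(p <- terms (Δ r.1)) p.1 ⊗ (p.2 ⊗ r.2) =
      \sum_(r <- terms R) \sum_(r' <- terms R) r.1 ⊗ (r'.1 ⊗ (r.2 * r'.2))
    & \sum_(r <- terms R) \sum_(p <- terms (Δ r.2)) r.1 ⊗ (p.1 ⊗ p.2) =
      \sum_(r <- terms R) \sum_(r' <- terms R) (r.1 * r'.1) ⊗ (r'.2 ⊗ r.2)].

Definition flip (x : H ⊗ H) : H ⊗ H := \sum_(p <- terms x) p.2 ⊗ p.1.

Definition almost_triangular (R : H ⊗ H) : Prop :=
  quasi_triangular R /\ tensor_of center center (tmul (flip R) R).

Definition adj (h x : H) : H := \sum_(p <- terms (Δ h)) p.1 * x * S p.2.

(* The coproduct of the transmuted braided group H_R. *)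
Definition comulR (R : H ⊗ H) (h : H) : H ⊗ H :=
  \sum_(p <- terms (Δ h)) \sum_(r <- terms R) (p.1 * S r.2) ⊗ adj r.1 p.2.

(* Subcoalgebras of (H, comulR R, counit); the counit imposes no condition. *)
Definition subcoalgR (R : H ⊗ H) (D : set H) : Prop :=
  subspace D /\ forall x, D x -> tensor_of D D (comulR R x).

End HopfTheory.

HB.mixin Record Lmodule_isYetterDrinfeld (k : fieldType) (H : hopfAlgType k) V
    of GRing.Lmodule k V := {
  act : {bilinear H -> V -> V};
  coact : {linear V -> ((H : lmodType k) ⊗ (V : lmodType k))%type};
  act1 : forall v : V, act 1 v = v;
  actM : forall (g h : H) (v : V), act (g * h) v = act g (act h v);
  coactA : forall v : V,
    \sum_(p <- terms (coact v)) \sum_(q <- terms (coact p.2))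
      p.1 ⊗ (q.1 ⊗ q.2) =
    \sum_(p <- terms (coact v)) \sum_(q <- terms (comul p.1))
      q.1 ⊗ (q.2 ⊗ p.2);
  coact_counit : forall v : V,
    \sum_(p <- terms (coact v)) counit p.1 *: p.2 = v;
  (* h_(1) v_<-1> ⊗ h_(2) v_<0> = (h_(1) v)_<-1> h_(2) ⊗ (h_(1) v)_<0> *)
  act_coact : forall (h : H) (v : V),
    \sum_(p <- terms (comul h)) \sum_(q <- terms (coact v))
      (p.1 * q.1) ⊗ act p.2 q.2 =
    \sum_(p <- terms (comul h)) \sum_(q <- terms (coact (act p.1 v)))
      (q.1 * p.2) ⊗ q.2;
}.

#[short(type="ydModType")]
HB.structure Definition YetterDrinfeld (k : fieldType) (H : hopfAlgType k) :=
  { V of GRing.Lmodule k V & Lmodule_isYetterDrinfeld k H V }.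

Section YetterDrinfeldTheory.
Variables (k : fieldType) (H : hopfAlgType k) (V : ydModType H).

Definition yd_submod (W : set V) : Prop :=
  [/\ subspace W, forall (h : H) v, W v -> W (act h v)
    & forall v, W v -> tensor_of [set: H] W (coact v)].

Definition yd_irreducible : Prop :=
  (exists v : V, v != 0) /\
  forall W, yd_submod W -> W = [set 0] \/ W = [set: V].

Definition coactR (R : H ⊗ H) (v : V) : H ⊗ V :=
  \sum_(p <- terms (coact v)) \sum_(r <- terms R)
    (p.1 * antipode r.2) ⊗ act r.1 p.2.

(* The smallest subcoalgebra D of H_R with coactR R V ⊆ D ⊗ V. *)
Definition D_ (R : H ⊗ H) : set H :=
  \bigcap_(D in [set D : set H | subcoalgR R D /\
                  forall v, tensor_of D [set: V] (coactR R v)]) D.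

End YetterDrinfeldTheory.

(* Main.v *)
Require Import Defs.
From HB Require Import structures.
From mathcomp Require Import all_boot all_order all_algebra.
From mathcomp Require Import boolp classical_sets zify.

Set Implicit Arguments.
Unset Strict Implicit.
Unset Printing Implicit Defensive.

Import GRing.Theory.
Local Open Scope ring_scope.

(** Write v_[-1] ⊗ v_[0] for ρ_R(v), and let E be the set of the operators
    v |-> f(v_[-1]) v_[0] on V, for f a functional on H.  Since ρ_R is a coaction
    of H_R, E is an algebra (coefop_comp), and expanding ρ_R along a basis of E
    shows that D_V and E are dual to each other (has_dim_D).  So the claim is
    that dim E divides dim V.  Three properties of E give this.

    - ρ_R is H-linear for the adjoint action on H_R, hence E is stable under
      h · φ = h_(1) φ S(h_(2)) (adop_coefop).  As ρ_R and the action determine the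
      coaction of V (coact_of_coactR), a subspace of V stable under H and under E
      is a Yetter-Drinfeld submodule, so it is 0 or V.
    - E is commutative up to the braiding: φ ψ = (R^2 · ψ) (R^1 · φ)
      (braided_commutative).  This is where R is almost-triangular: the two sides
      differ by factors of R21 R, which, being central, can be collected into
      z^1 z'^1 ⊗ S(z^2) z'^2 with z = z' = R21 R, and this is 1 ⊗ 1
      (comulR_braided).
    - Therefore v · φ = (R^2 · φ) (R^1 v) is a right action of E on V which
      commutes with the left one (ract_comm, ract_comp).

    The rest is linear algebra over the finite-dimensional algebra E
    (algebra_dim_dvd).  For an E-module X put f(X) = dim Hom_E(V, X), and let μ be
    the largest ratio f(X) / dim X; f is subadditive along short exact sequences,
    so the modules with f(X) = μ dim X, called tight, are closed under submodules
    and quotients.  Let S be a nonzero tight module; as μ > 0, there is a nonzero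
    E-map g : V -> S.  The space Hom(H, S), on which x in E acts by
    (x ξ)(h) = (h_(1) · x) ξ(h_(2)), is tight too, because the antipode is
    bijective.  An x in E that kills it satisfies (h · x) S = 0 for all h, so x maps
    V into the largest H-stable subspace of the kernel of g; this subspace is also
    E-stable, hence 0, and x = 0.  So E embeds in a power of Hom(H, S), E is tight,
    and every module is tight, being a quotient of a power of E.  For X = E^* this
    reads dim V = μ dim E.  Finally the right action makes Hom_E(V, X) an E-module, of
    dimension μ dim X; iterating, μ^m dim X is an integer for every m, hence μ is
    an integer.

    Finite-dimensionality of H comes from the integral that semisimplicity
    provides (hopf_findim), and that of V from the one of H (yd_findim). *)

(** * Modules over a finite-dimensional algebra *)

Definition mklin (k : fieldType) (U W : lmodType k) (f : U -> W)
    (Hf : linear f) : {linear U -> W} :=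
  HB.pack f (GRing.isLinear.Build k U W *:%R f Hf).

Definition mkHom (k : fieldType) (U W : vectType k) (f : U -> W)
  (Hf : linear f) : 'Hom(U, W) := linfun (mklin Hf).

Lemma mkHomE (k : fieldType) (U W : vectType k) (f : U -> W)
  (Hf : linear f) x : mkHom Hf x = f x.
Proof. by rewrite /mkHom lfunE. Qed.

(** A subspace of largest dimension among those inside P exhausts P, so spaces
    cut out by linear conditions need no explicit equations. *)
Lemma vspace_comprehension (k : fieldType) (W : vectType k) (P : W -> Prop) :
  P 0 -> (forall a x y, P x -> P y -> P (a *: x + y)) ->
  {U : {vspace W} | forall x, x \in U <-> P x}.
Proof.
move=> P0 PL; apply: cid.
pose Q n := `[< exists2 U : {vspace W}, \dim U = n & forall x, x \in U -> P x >].
have exQ : exists n, Q n.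
  exists 0%N; apply/asboolP; exists 0%VS; first exact: dimv0.
  by move=> x; rewrite memv0 => /eqP ->.
have bQ n : Q n -> (n <= \dim (fullv : {vspace W}))%N.
  by move=> /asboolP[U <- _]; apply/dimvS/subvf.
have [n /asboolP[U dU UP] maxn] := ex_maxnP exQ bQ.
exists U => x; split; first exact: UP.
move=> Px.
have /maxn : Q (\dim (U + <[x]>)%VS).
  apply/asboolP; exists (U + <[x]>)%VS => // y /memv_addP[u uU [_ /vlineP[a ->]] ->].
  by rewrite addrC; apply: PL => //; apply: UP.
rewrite -dU => le.
have /eqP : U == (U + <[x]>)%VS by rewrite eqEdim addvSl.
by move=> ->; rewrite (subvP (addvSr _ _)) // memv_line.
Qed.

Section Alg.
Variables (k : fieldType) (E : vectType k) (mul : E -> E -> E) (one : E).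
Hypothesis mull : forall b, linear (mul^~ b).
Hypothesis mulr : forall a, linear (mul a).
Hypothesis mulA : associative mul.
Hypothesis mul1 : left_id one mul.
Hypothesis mul1r : right_id one mul.

(** E is given by a bare multiplication rather than by a ring structure, because
    it will be a space of operators closed under composition. *)
Record algmod := AlgMod {
  modcar :> vectType k;
  eact : E -> modcar -> modcar;
  eactl : forall x, linear (eact^~ x);
  eactr : forall e, linear (eact e);
  eact1 : forall x, eact one x = x;
  eactM : forall a b x, eact (mul a b) x = eact a (eact b x) }.

Definition moddim (X : algmod) := \dim (fullv : {vspace X}).

Definition equivariant (X Y : algmod) (f : 'Hom(X, Y)) :=
  forall e x, f (eact e x) = eact e (f x).

Lemma eactD (X : algmod) e (x y : X) : eact e (x + y) = eact e x + eact e y.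
Proof. by have := eactr e 1 x y; rewrite !scale1r. Qed.
Lemma eact0 (X : algmod) e : eact e (0 : X) = 0.
Proof. by apply: (addrI (eact e 0)); rewrite -eactD !addr0. Qed.
Lemma eactZ (X : algmod) e a (x : X) : eact e (a *: x) = a *: eact e x.
Proof. by have := eactr e a x 0; rewrite eact0 !addr0. Qed.
Lemma eact_sum (X : algmod) e I (r : seq I) P (F : I -> X) :
  eact e (\sum_(i <- r | P i) F i) = \sum_(i <- r | P i) eact e (F i).
Proof. exact: (big_morph _ (eactD e) (eact0 _ e)). Qed.

Lemma eact_scale (X : algmod) e a (x : X) : eact (a *: e) x = a *: eact e x.
Proof.
have e0 : eact 0 x = 0.
  by have := eactl x (-1) e e; rewrite !scaleN1r !addNr.
by have := eactl x a e 0; rewrite e0 !addr0.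
Qed.
Lemma eact_suml (X : algmod) I (r : seq I) (F : I -> E) (x : X) :
  eact (\sum_(i <- r) F i) x = \sum_(i <- r) eact (F i) x.
Proof.
apply: (big_morph (fun e => eact e x)) => [a b|].
  by have := eactl x 1 a b; rewrite !scale1r.
by have := eact_scale 0 0 x; rewrite !scale0r.
Qed.

Fact equivariant_vspace (X Y : algmod) :
  {U : {vspace 'Hom(X, Y)} | forall f, f \in U <-> equivariant f}.
Proof.
apply: vspace_comprehension => [e x|a f g Hf Hg e x].
  by rewrite !zero_lfunE eact0.
by rewrite !add_lfunE !scale_lfunE Hf Hg eactr.
Qed.

Definition eqhom (X Y : algmod) := sval (equivariant_vspace X Y).
Lemma eqhomP (X Y : algmod) (f : 'Hom(X, Y)) : f \in eqhom X Y <-> equivariant f.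
Proof. exact: (svalP (equivariant_vspace X Y) f). Qed.

Section Hom.
Variable V : algmod.
Definition hom_dim (X : algmod) := \dim (eqhom V X).

(** Left exactness of Hom_E(V, -). *)
Lemma hom_dim_exact (X Y Z : algmod) (i : 'Hom(X, Y)) (p : 'Hom(Y, Z)) :
  equivariant i -> equivariant p -> lker i == 0%VS ->
  (lker p <= limg i)%VS -> (hom_dim Y <= hom_dim X + hom_dim Z)%N.
Proof.
move=> Hi Hp inj ker.
pose post (A B : algmod) (h : 'Hom(A, B)) (g : 'Hom(V, A)) : 'Hom(V, B) := (h \o g)%VF.
have lpost A B h : linear (@post A B h).
  move=> a g1 g2; apply/lfunP => v.
  by rewrite /post comp_lfunE !add_lfunE !scale_lfunE !comp_lfunE linearP.
pose Pp := mkHom (lpost _ _ p); pose Pi := mkHom (lpost _ _ i).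
rewrite /hom_dim -(limg_ker_dim Pp (eqhom V Y)) leq_add //; last first.
  apply/dimvS/subvP => _ /memv_imgP[g /eqhomP Hg ->].
  by apply/eqhomP => e x; rewrite mkHomE /post !comp_lfunE Hg Hp.
have dimi : (\dim (Pi @: eqhom V X) <= \dim (eqhom V X))%N.
  by rewrite -(limg_ker_dim Pi (eqhom V X)) leq_addl.
apply: leq_trans dimi; apply/dimvS/subvP => g.
rewrite memv_cap => /andP[/eqhomP Hg].
rewrite memv_ker => /eqP kg.
have im v : g v \in limg i.
  apply: (subvP ker); rewrite memv_ker.
  by move/lfunP: kg => /(_ v); rewrite mkHomE comp_lfunE zero_lfunE => ->.
have iK v : i ((i^-1)%VF (g v)) = g v by apply: limg_lfunVK.
apply/memv_imgP; exists (i^-1 \o g)%VF.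
  apply/eqhomP => e x; rewrite !comp_lfunE.
  by move/lker0P: (inj); apply; rewrite Hi !iK Hg.
by apply/lfunP => v; rewrite mkHomE !comp_lfunE iK.
Qed.
End Hom.

Section SubQuo.
Variables (X : algmod) (U : {vspace X}).
Hypothesis stab : forall e x, x \in U -> eact e x \in U.

Let sact e (x : subvs_of U) := vsproj U (eact e (vsval x)).
Let sactE e x : vsval (sact e x) = eact e (vsval x).
Proof. by rewrite vsprojK // stab // subvsP. Qed.

Lemma submodule_exists : exists Y : algmod, exists2 i : 'Hom(Y, X),
  equivariant i & (lker i == 0%VS) /\ limg i = U.
Proof.
have al x : linear (sact^~ x).
  by move=> a e1 e2; rewrite /sact eactl linearP.
have ar e : linear (sact e).
  by move=> a x1 x2; rewrite /sact linearP eactr linearP.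
have a1 x : sact one x = x by rewrite /sact eact1 vsvalK.
have aM a b x : sact (mul a b) x = sact a (sact b x).
  by apply: val_inj; rewrite /= !sactE eactM.
exists (@AlgMod (subvs_of U) sact al ar a1 aM), (linfun (@vsval _ _ U)).
  by move=> e x; rewrite !lfunE /= sactE.
split; first by apply/lker0P => x y; rewrite !lfunE; apply: val_inj.
apply/vspaceP => x; apply/memv_imgP/idP => [[y _ ->]|xU].
  by rewrite lfunE subvsP.
by exists (vsproj U x); rewrite ?memvf // lfunE /= vsprojK.
Qed.

Lemma quotient_exists : exists Y : algmod, exists2 p : 'Hom(X, Y),
  equivariant p & lker p = U /\ limg p = fullv.
Proof.
pose C := (U^C)%VS.
have capUC : (C :&: U = 0)%VS by rewrite capvC capv_compl.
have sumUC x : x \in (C + U)%VS by rewrite addvC addv_complf memvf.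
pose p (x : X) : subvs_of C := vsproj C (daddv_pi C U x).
have pL : linear p by move=> a x y; rewrite /p !linearP.
have pE x : vsval (p x) = daddv_pi C U x by rewrite /p vsprojK // memv_pi.
have decomp x : x - vsval (p x) \in U.
  have := daddv_pi_add capUC (sumUC x); rewrite pE => {1}<-.
  by rewrite addrC addKr memv_pi.
have pU x : x \in U -> p x = 0.
  move=> xU; apply: (can_inj vsvalK); rewrite pE linear0.
  have : daddv_pi C U x \in (C :&: U)%VS.
    by rewrite memv_cap memv_pi -pE -[vsval (p x)](subKr x) rpredB // decomp.
  by rewrite capUC memv0 => /eqP.
have pK y : p (vsval y) = y.
  by apply: val_inj; rewrite [LHS]pE daddv_pi_id // subvsP.
have pD x y : p (x - y) = p x - p y.
  by rewrite -[p x - p y]addrC -!scaleN1r -pL addrC.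
pose act e (y : subvs_of C) := p (eact e (vsval y)).
have pact e x : p (eact e x) = act e (p x).
  apply/eqP; rewrite -subr_eq0 /act -pD -[- _]scaleN1r -eactZ -eactD.
  by rewrite scaleN1r pU // stab // decomp.
have al x : linear (act^~ x).
  by move=> a e1 e2; rewrite /act eactl pL.
have ar e : linear (act e).
  by move=> a x1 x2; rewrite /act linearP eactr pL.
have a1 x : act one x = x by rewrite /act eact1 pK.
have aM a b x : act (mul a b) x = act a (act b x).
  by rewrite {1}/act eactM pact.
exists (@AlgMod (subvs_of C) act al ar a1 aM), (mkHom pL).
  by move=> e x; rewrite !mkHomE pact.
split.
  apply/vspaceP => x; rewrite memv_ker mkHomE; apply/eqP/idP => [p0|/pU //].
  by have := decomp x; rewrite p0 (linear0 (@vsval _ _ C)) subr0.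
apply/vspaceP => y; rewrite memvf; apply/memv_imgP.
by exists (vsval y); rewrite ?memvf // mkHomE pK.
Qed.
End SubQuo.

Lemma moddim_quotient (X : algmod) (U : {vspace X}) (Y : algmod) (p : 'Hom(X, Y)) :
  lker p = U -> limg p = fullv -> (moddim Y + \dim U)%N = moddim X.
Proof.
move=> <- sur; rewrite addnC /moddim -(limg_ker_dim p fullv) capfv.
by congr (_ + \dim _)%N; rewrite sur.
Qed.

Lemma moddim_embed (X Y : algmod) (i : 'Hom(X, Y)) :
  lker i == 0%VS -> \dim (limg i) = moddim X.
Proof. by move=> /eqP ker; rewrite limg_dim_eq // ker capv0. Qed.

Section Ratio.
Variable V : algmod.
Hypothesis Vn0 : (0 < moddim V)%N.
Local Notation f := (hom_dim V).

Lemma ker_stable (X Y : algmod) (p : 'Hom(X, Y)) : equivariant p ->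
  forall e x, x \in lker p -> eact e x \in lker p.
Proof. by move=> Hp e x; rewrite !memv_ker Hp => /eqP ->; rewrite eact0. Qed.

Lemma img_stable (X Y : algmod) (p : 'Hom(X, Y)) : equivariant p ->
  forall e x, x \in limg p -> eact e x \in limg p.
Proof. by move=> Hp e _ /memv_imgP[x _ ->]; rewrite -Hp memv_img ?memvf. Qed.

Lemma hom_dim_split (X : algmod) (U : {vspace X}) :
  (forall e x, x \in U -> eact e x \in U) ->
  exists Y Z : algmod, [/\ moddim Y = \dim U, (moddim Z + moddim Y)%N = moddim X &
    (f X <= f Y + f Z)%N].
Proof.
move=> stab.
have [Y [i Hi [inj im]]] := submodule_exists stab.
have [Z [p Hp [ker sur]]] := quotient_exists stab.
have dY : moddim Y = \dim U by rewrite -(moddim_embed inj) im.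
exists Y, Z; split=> //; first by rewrite dY; apply: moddim_quotient sur.
by apply: hom_dim_exact Hi Hp inj _; rewrite ker im.
Qed.

Lemma hom_dim_zero (X : algmod) : moddim X = 0%N -> f X = 0%N.
Proof.
move=> X0; apply/eqP; rewrite -leqn0.
have -> : 0%N = \dim (0%VS : {vspace 'Hom(V, X)}) by rewrite dimv0.
apply/dimvS/subvP => g _; rewrite memv0; apply/eqP/lfunP => v.
rewrite zero_lfunE; apply/eqP; rewrite -memv0.
have /eqP <- : (fullv : {vspace X}) == 0%VS by rewrite -dimv_eq0 -/(moddim X) X0.
exact: memvf.
Qed.

Section MaximalRatio.
Variable S : algmod.
Hypothesis S0 : (0 < moddim S)%N.
Hypothesis Smax : forall X, (0 < moddim X <= \dim (fullv : {vspace E}))%N ->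
  (f X * moddim S <= f S * moddim X)%N.

(** A module of dimension larger than dim E has a proper nonzero submodule, namely
    any cyclic one, so the extremality of S among small modules propagates to all
    modules by subadditivity. *)
Lemma hom_dim_bound (X : algmod) : (f X * moddim S <= f S * moddim X)%N.
Proof.
have [n] := ubnP (moddim X); elim: n X => // n IH X; rewrite ltnS => leXn.
have [X0|X0] := posnP (moddim X); first by rewrite hom_dim_zero.
have [small|big] := leqP (moddim X) (\dim (fullv : {vspace E})).
  by apply: Smax; rewrite X0.
have [x xn0] : exists x : X, x != 0.
  exists (vpick (fullv : {vspace X})).
  by rewrite vpick0 -dimv_eq0 -/(moddim X) -lt0n.
pose U := limg (mkHom (eactl x)).
have stab e y : y \in U -> eact e y \in U.
  move=> /memv_imgP[e' _ ->]; rewrite mkHomE -eactM.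
  by apply/memv_imgP; exists (mul e e'); rewrite ?memvf // mkHomE.
have U0 : (0 < \dim U)%N.
  rewrite lt0n dimv_eq0; apply: contraNneq xn0 => U0.
  rewrite -memv0 -U0; apply/memv_imgP; exists one; rewrite ?memvf //.
  by rewrite mkHomE eact1.
have UE : (\dim U <= \dim (fullv : {vspace E}))%N.
  by rewrite /U -[X in (_ <= X)%N](limg_ker_dim (mkHom (eactl x))) leq_addl.
have [Y [Z [dY dZ le]]] := hom_dim_split stab.
apply: leq_trans (leq_mul le (leqnn _)) _.
rewrite mulnDl -dZ addnC mulnDr; apply: leq_add; apply: IH.
  apply: leq_trans leXn; rewrite -dZ dY -[X in (X < _)%N]addn0 ltn_add2l //.
rewrite dY; apply: leq_ltn_trans UE _; exact: leq_trans big leXn.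
Qed.

Definition tight (X : algmod) := (f X * moddim S = f S * moddim X)%N.

(** Equality in a sum of two inequalities forces equality in both. *)
Lemma tight_split (X Y Z : algmod) : tight X -> (moddim Z + moddim Y)%N = moddim X ->
  (f X <= f Y + f Z)%N -> tight Y /\ tight Z.
Proof.
rewrite /tight => tX d le.
have bY := hom_dim_bound Y; have bZ := hom_dim_bound Z.
have : (f S * moddim Z + f S * moddim Y <= f Y * moddim S + f Z * moddim S)%N.
  by rewrite -mulnDr d -tX -mulnDl leq_mul2r le orbT.
move: bY bZ; rewrite /tight; lia.
Qed.

Lemma tight_sub (X Y : algmod) (i : 'Hom(Y, X)) : equivariant i ->
  lker i == 0%VS -> tight X -> tight Y.
Proof.
move=> Hi inj tX.
have [Z [p Hp [ker sur]]] := quotient_exists (img_stable Hi).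
have d := moddim_quotient ker sur; rewrite moddim_embed // in d.
have le : (f X <= f Y + f Z)%N by apply: hom_dim_exact Hi Hp inj _; rewrite ker.
by have [] := tight_split tX d le.
Qed.

Lemma tight_quotient (X Z : algmod) (p : 'Hom(X, Z)) : equivariant p ->
  limg p = fullv -> tight X -> tight Z.
Proof.
move=> Hp sur tX.
have [Y [i Hi [inj im]]] := submodule_exists (ker_stable Hp).
have d := moddim_quotient (erefl _) sur.
rewrite -im moddim_embed // in d.
have le : (f X <= f Y + f Z)%N by apply: hom_dim_exact Hi Hp inj _; rewrite im.
by have [] := tight_split tX d le.
Qed.
End MaximalRatio.

Local Notation dimE := (\dim (fullv : {vspace E})).

(** Hom_E(V, E^* ) is V^*: a map is determined by its values at the unit of E. *)
Fact dual_module : exists X : algmod, moddim X = dimE /\ f X = moddim V.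
Proof.
pose act e (xi : 'Hom(E, k^o)) := (xi \o mkHom (mull e))%VF.
have actE e xi x : act e xi x = xi (mul x e).
  by rewrite /act comp_lfunE mkHomE.
have al xi : linear (act^~ xi).
  move=> a e1 e2; apply/lfunP => x.
  by rewrite add_lfunE scale_lfunE !actE mulr linearP.
have ar e : linear (act e).
  by move=> a x1 x2; apply/lfunP => x; rewrite !(actE, add_lfunE, scale_lfunE).
have a1 xi : act one xi = xi by apply/lfunP => x; rewrite actE mul1r.
have aM a b xi : act (mul a b) xi = act a (act b xi).
  by apply/lfunP => x; rewrite !actE mulA.
pose X := AlgMod al ar a1 aM; exists X.
have dH (W : vectType k) : \dim (fullv : {vspace 'Hom(W, k^o)}) = \dim (fullv : {vspace W}).
  by rewrite !dimvf; apply: muln1.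
split; first exact: dH.
pose Psi (xi : 'Hom(V, k^o)) : 'Hom(V, X) :=
  linfun (fun v : V => (xi \o mkHom (eactl v))%VF : X).
have PsiL xi : linear (fun v : V => (xi \o mkHom (eactl v))%VF : X).
  move=> a v w; apply/lfunP => x.
  by rewrite add_lfunE scale_lfunE !comp_lfunE !mkHomE eactr linearP.
have PsiE xi v x : (Psi xi v : 'Hom(E, k^o)) x = xi (eact x v).
  by rewrite /Psi (mkHomE (PsiL xi)) comp_lfunE mkHomE.
have PsiLL : linear Psi.
  move=> a xi et; apply/lfunP => v; apply/lfunP => x.
  by rewrite PsiE !(add_lfunE, scale_lfunE) !PsiE.
have inj : lker (mkHom PsiLL) == 0%VS.
  apply/lker0P => xi et; rewrite !mkHomE => e; apply/lfunP => v.
  by rewrite -[v]eact1 -!PsiE e.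
rewrite /hom_dim /moddim -(dH V) -(limg_dim_eq (f := mkHom PsiLL)); last first.
  by rewrite (eqP inj) capv0.
congr (\dim _); apply/vspaceP => g; apply/idP/memv_imgP.
  move=> /eqhomP Hg.
  have xiL : linear (fun v => (g v : 'Hom(E, k^o)) one).
    by move=> a v w; rewrite linearP !(add_lfunE, scale_lfunE).
  exists (mkHom xiL); rewrite ?memvf // mkHomE; apply/lfunP => v.
  by apply/lfunP => x; rewrite PsiE mkHomE Hg actE mul1.
move=> [xi _ ->]; rewrite mkHomE; apply/eqhomP => e v.
by apply/lfunP => x; rewrite PsiE actE PsiE eactM.
Qed.

Lemma dimE_gt0 : (0 < dimE)%N.
Proof.
rewrite lt0n dimv_eq0; apply: contraTneq Vn0 => E0; rewrite -eqn0Ngt dimv_eq0.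
have one0 : one = 0 by apply/eqP; rewrite -memv0 -E0 memvf.
rewrite -subv0; apply/subvP => v _; rewrite memv0 -[v]eact1 one0.
by rewrite -(scale0r one) eact_scale scale0r.
Qed.

Lemma hom_dim_le (X : algmod) : (f X <= moddim V * moddim X)%N.
Proof.
apply: leq_trans (dimvS (subvf _)) _; rewrite /moddim !dimvf; exact: leqnn.
Qed.

(** The ratios f(X) / dim X with 0 < dim X <= dim E have the common denominator
    (dim E)!, so a largest one is found among bounded natural numbers. *)
Lemma max_ratio : exists S : algmod, [/\ (0 < moddim S)%N, (0 < f S)%N &
  forall X, (0 < moddim X <= dimE)%N -> (f X * moddim S <= f S * moddim X)%N].
Proof.
pose c X := (dimE`! %/ moddim X)%N.
have cE X : (0 < moddim X <= dimE)%N -> (c X * moddim X = dimE`!)%N.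
  by move=> h; rewrite divnK // dvdn_fact.
pose Q n := `[< exists2 X : algmod, (0 < moddim X <= dimE)%N & (f X * c X)%N = n >].
have [D [dD fD]] := dual_module.
have Drange : (0 < moddim D <= dimE)%N by rewrite dD leqnn dimE_gt0.
have exQ : exists n, Q n by exists (f D * c D)%N; apply/asboolP; exists D.
have bQ n : Q n -> (n <= moddim V * dimE`!)%N.
  move=> /asboolP[X /cE <- <-]; apply: leq_trans (leq_mul (hom_dim_le X) (leqnn _)) _.
  by rewrite -mulnA [(moddim X * _)%N]mulnC.
have [n /asboolP[S Srange Sn] maxn] := ex_maxnP exQ bQ.
have Smax X : (0 < moddim X <= dimE)%N -> (f X * moddim S <= f S * moddim X)%N.
  move=> Xr; have /maxn : Q (f X * c X)%N by apply/asboolP; exists X.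
  rewrite -Sn => le.
  rewrite -(leq_pmul2r (fact_gt0 dimE)) -{1}(cE _ Xr) -(cE _ Srange).
  have := leq_mul le (leqnn (moddim X * moddim S)); lia.
case/andP: (Srange) => S0 _; exists S; split=> //.
have := Smax D Drange; rewrite fD lt0n.
by apply: contraTneq => ->; rewrite mul0n -ltnNge muln_gt0 Vn0.
Qed.

(** A coordinate form of a Hopf algebra acting on V and E.  If a basis h_i has
    coproduct Δ(h_i) = Σ_j G_ij ⊗ h_j, then tcoef, tmap and tinv are the action of
    G_ij on E, its action on V, and the action on V of its inverse antipode;
    tmapE is h φ(v) = (h_(1) · φ)(h_(2) v).  The trivial coalgebra with d grouplike
    elements gives direct sums, see diagonal_twist. *)
Record twist := Twist {
  tdim : nat;
  tcoef : 'I_tdim -> 'I_tdim -> E -> E;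
  tmap : 'I_tdim -> 'I_tdim -> V -> V;
  tinv : 'I_tdim -> 'I_tdim -> V -> V;
  tcoef_linear : forall i j, linear (tcoef i j);
  tcoef1 : forall i j, tcoef i j one = (i == j)%:R *: one;
  tcoefM : forall i j a b, tcoef i j (mul a b) =
     \sum_l mul (tcoef i l a) (tcoef l j b);
  tmap_linear : forall i j, linear (tmap i j);
  tinv_linear : forall i j, linear (tinv i j);
  tmapE : forall i j e v, tmap i j (eact e v) =
     \sum_l eact (tcoef i l e) (tmap l j v);
  tmapK : forall j l v, \sum_i tmap i j (tinv l i v) = (j == l)%:R *: v }.

Section Twisted.
Variables (T : twist) (X : algmod).
Local Notation d := (tdim T).

Let tact e (xi : {ffun 'I_d -> X}) : {ffun 'I_d -> X} :=
  [ffun i => \sum_j eact (tcoef i j e) (xi j)].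

Let tactl xi : linear (tact^~ xi).
Proof.
move=> a e1 e2; apply/ffunP => i; rewrite !ffunE scaler_sumr -big_split /=.
by apply: eq_bigr => j _; rewrite tcoef_linear eactl.
Qed.
Let tactr e : linear (tact e).
Proof.
move=> a x y; apply/ffunP => i; rewrite !ffunE scaler_sumr -big_split /=.
by apply: eq_bigr => j _; rewrite !ffunE eactr.
Qed.

Let tact1 xi : tact one xi = xi.
Proof.
apply/ffunP => i; rewrite ffunE (bigD1 i) //= tcoef1 eqxx scale1r eact1.
rewrite big1 ?addr0 // => j ji; rewrite tcoef1 eq_sym (negPf ji).
by rewrite eact_scale scale0r.
Qed.

Let tactM a b xi : tact (mul a b) xi = tact a (tact b xi).
Proof.
apply/ffunP => i; rewrite !ffunE.
under eq_bigr do rewrite tcoefM eact_suml.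
rewrite exchange_big /=; apply: eq_bigr => l _; rewrite ffunE eact_sum.
by apply: eq_bigr => j _; rewrite eactM.
Qed.

(** The module Hom(H, X), with (e ξ)(h) = (h_(1) · e) ξ(h_(2)). *)
Definition twisted := AlgMod tactl tactr tact1 tactM.

Lemma moddim_twisted : moddim twisted = (d * moddim X)%N.
Proof. by rewrite /moddim !dimvf /dim /= card_ord. Qed.

(** The map χ |-> (v |-> (h |-> χ(h_(2))(h_(1) v))) embeds Hom(H, Hom_E(V, X)) into
    Hom_E(V, Hom(H, X)); it is injective because h ⊗ v |-> h_(2) ⊗ h_(1) v is onto. *)
Lemma hom_dim_twisted : (d * f X <= f twisted)%N.
Proof.
pose F := {ffun 'I_d -> subvs_of (eqhom V X)}.
have dF : \dim (fullv : {vspace F}) = (d * f X)%N.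
  by rewrite dimvf /dim /= card_ord.
pose Th0 (chi : F) (v : V) : twisted := [ffun i => \sum_j vsval (chi j) (tmap i j v)].
have Th0L chi : linear (Th0 chi).
  move=> a v w; apply/ffunP => i; rewrite !ffunE scaler_sumr -big_split /=.
  by apply: eq_bigr => j _; rewrite tmap_linear linearP.
pose Th chi := mkHom (Th0L chi).
have ThL : linear Th.
  move=> a chi et; apply/lfunP => v; rewrite add_lfunE scale_lfunE !mkHomE.
  apply/ffunP => i; rewrite !ffunE scaler_sumr -big_split /=.
  by apply: eq_bigr => j _; rewrite !ffunE linearP add_lfunE scale_lfunE.
have inj : lker (mkHom ThL) == 0%VS.
  rewrite -subv0; apply/subvP => chi; rewrite memv_ker mkHomE => /eqP chi0.
  rewrite memv0; apply/eqP/ffunP => l; rewrite ffunE; apply: (can_inj vsvalK).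
  rewrite linear0; apply/lfunP => v; rewrite zero_lfunE.
  have e i : \sum_j vsval (chi j) (tmap i j (tinv l i v)) = 0.
    by move/lfunP: chi0 => /(_ (tinv l i v)); rewrite mkHomE zero_lfunE => /ffunP/(_ i);
        rewrite !ffunE.
  have : \sum_i \sum_j vsval (chi j) (tmap i j (tinv l i v)) = 0.
    by rewrite big1.
  rewrite exchange_big /=; under eq_bigr do rewrite -linear_sum tmapK linearZ.
  rewrite (bigD1 l) //= eqxx scale1r big1 ?addr0 // => j /negPf ->.
  by rewrite scale0r.
rewrite -dF -(limg_dim_eq (f := mkHom ThL)); last by rewrite (eqP inj) capv0.
apply/dimvS/subvP => _ /memv_imgP[chi _ ->]; rewrite mkHomE.
apply/eqhomP => e v; rewrite !mkHomE; apply/ffunP => i; rewrite !ffunE.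
under eq_bigr do rewrite tmapE linear_sum.
rewrite exchange_big /=; apply: eq_bigr => l _; rewrite ffunE eact_sum.
by apply: eq_bigr => j _; have /eqhomP := subvsP (chi j); apply.
Qed.
End Twisted.

Section Diagonal.
Variable d : nat.
Definition diag (W : vectType k) (i j : 'I_d) (x : W) := (i == j)%:R *: x.

Lemma diag_linear (W : vectType k) i j : linear (@diag W i j).
Proof. by move=> a x y; rewrite /diag scalerDr !scalerA mulrC. Qed.

Lemma mulZl a e e' : mul (a *: e) e' = a *: mul e e'.
Proof.
have z : mul 0 e' = 0 by have := mull e' (-1) e e; rewrite !scaleN1r !addNr.
by have := mull e' a e 0; rewrite z !addr0.
Qed.

Lemma mulZr a e e' : mul e (a *: e') = a *: mul e e'.
Proof.
have z : mul e 0 = 0 by have := mulr e (-1) e' e'; rewrite !scaleN1r !addNr.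
by have := mulr e a e' 0; rewrite z !addr0.
Qed.

Lemma sum_delta (W : lmodType k) (i : 'I_d) (F : 'I_d -> W) :
  \sum_l (i == l)%:R *: F l = F i.
Proof.
rewrite (bigD1 i) //= eqxx scale1r big1 ?addr0 // => l.
by rewrite eq_sym => /negPf ->; rewrite scale0r.
Qed.

Fact diagM i j a b :
  diag i j (mul a b) = \sum_l mul (diag i l a) (diag l j b).
Proof. by under eq_bigr do rewrite mulZl mulZr; rewrite sum_delta. Qed.

Fact diag_tmap i j e (v : V) :
  diag i j (eact e v) = \sum_l eact (diag i l e) (diag l j v).
Proof. by under eq_bigr do rewrite eact_scale eactZ; rewrite sum_delta. Qed.

Fact diagK j l (v : V) : \sum_i diag i j (diag l i v) = (j == l)%:R *: v.
Proof.
by under eq_bigr => i _ do rewrite /diag [i == j]eq_sym; rewrite sum_delta eq_sym.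
Qed.

(** Twisting along it is the d-fold direct sum. *)
Definition diagonal_twist : twist := @Twist d (@diag E) (@diag V) (@diag V)
  (@diag_linear E) (fun i j => erefl) diagM (@diag_linear V) (@diag_linear V)
  diag_tmap diagK.

Lemma eact_diagonal (X : algmod) e (xi : twisted diagonal_twist X) i :
  (eact e xi : {ffun _ -> _}) i = eact e ((xi : {ffun 'I_d -> X}) i).
Proof.
rewrite ffunE; under eq_bigr do rewrite eact_scale.
by rewrite sum_delta.
Qed.
End Diagonal.

Definition regular_module : algmod := @AlgMod E mul mull mulr mul1 (fun a b x => esym
    (mulA a b x)).

Section Main.
Variable T : twist.
Hypothesis faith : forall (S : algmod) (g : 'Hom(V, S)) x, equivariant g ->
  g != 0 -> (forall i j (y : S), eact (@tcoef T i j x) y = 0) -> x = 0.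
Variable ract : E -> V -> V.
Hypothesis ractl : forall v, linear (ract^~ v).
Hypothesis ractr : forall e, linear (ract e).
Hypothesis ract1 : forall v, ract one v = v.
Hypothesis ractM : forall a b v, ract (mul a b) v = ract b (ract a v).
Hypothesis ractC : forall a b v, eact a (ract b v) = ract b (eact a v).

Section HomModule.
Variable X : algmod.
Let U := eqhom V X.
Let hact e (g : subvs_of U) : subvs_of U := vsproj U (vsval g \o mkHom (ractr e))%VF.
Let hactE e g v : vsval (hact e g) v = vsval g (ract e v).
Proof.
rewrite vsprojK ?comp_lfunE ?mkHomE //; apply/eqhomP => e' x.
rewrite !comp_lfunE !mkHomE -ractC; have /eqhomP := subvsP g; exact.
Qed.
Let hactl g : linear (hact^~ g).
Proof.
move=> a e1 e2; apply: (can_inj vsvalK); apply/lfunP => v.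
by rewrite linearP add_lfunE scale_lfunE !hactE ractl linearP.
Qed.
Let hactr e : linear (hact e).
Proof.
move=> a g1 g2; apply: (can_inj vsvalK); apply/lfunP => v.
by rewrite linearP add_lfunE scale_lfunE !hactE linearP add_lfunE scale_lfunE.
Qed.
Let hact1 g : hact one g = g.
Proof. by apply: (can_inj vsvalK); apply/lfunP => v; rewrite hactE ract1. Qed.
Let hactM a b g : hact (mul a b) g = hact a (hact b g).
Proof.
by apply: (can_inj vsvalK); apply/lfunP => v; rewrite !hactE ractM.
Qed.
(** Hom_E(V, X) is a left E-module through the right action of E on V. *)
Definition hom_module : algmod := AlgMod hactl hactr hact1 hactM.
Lemma moddim_hom_module : moddim hom_module = f X.
Proof. by rewrite /moddim dimvf. Qed.
End HomModule.

Section Tight.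
Variable S : algmod.
Hypothesis S0 : (0 < moddim S)%N.
Hypothesis fS0 : (0 < f S)%N.
Hypothesis Smax : forall X, (0 < moddim X <= dimE)%N ->
  (f X * moddim S <= f S * moddim X)%N.

Lemma tight_twisted T' X : tight S X -> tight S (twisted T' X).
Proof.
rewrite /tight => tX; apply/eqP; rewrite eqn_leq hom_dim_bound //= moddim_twisted.
by rewrite mulnCA -tX mulnA leq_mul2r hom_dim_twisted orbT.
Qed.

(** x |-> (x w)_w, for w in a basis of the twist of S, embeds E: an x in its kernel
    kills that twist, and the hypothesis faith makes it 0. *)
Lemma tight_regular : tight S regular_module.
Proof.
pose W := twisted T S; pose b := vbasis (fullv : {vspace W}).
pose r := \dim (fullv : {vspace W}).
pose i0 (x : regular_module) : twisted (diagonal_twist r) W := [ffun i => eact x (tnth b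
    i)].
have i0L : linear i0.
  by move=> a x y; apply/ffunP => i; rewrite !ffunE eactl.
have i0E : equivariant (mkHom i0L).
  move=> e x; rewrite !mkHomE; apply/ffunP => i.
  by rewrite eact_diagonal !ffunE -eactM.
apply: (tight_sub S0 Smax i0E); last by apply/tight_twisted/tight_twisted.
rewrite -subv0; apply/subvP => x; rewrite memv_ker mkHomE => /eqP x0.
have xb w : eact x (w : W) = 0.
  have /coord_vbasis -> : w \in (fullv : {vspace W}) by rewrite memvf.
  rewrite eact_sum big1 // => i _; rewrite eactZ.
  by move/ffunP: x0 => /(_ i); rewrite !ffunE (tnth_nth 0) => ->; rewrite scaler0.
have [g gin gn0] : exists2 g, g \in eqhom V S & g != 0.
  exists (vpick (eqhom V S)); first exact: memv_pick.
  by rewrite vpick0 -dimv_eq0 -lt0n.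
rewrite memv0; apply/eqP/(faith (S := S) (g := g)) => //; first exact/eqhomP.
move=> i j y; have /ffunP/(_ i) := xb [ffun l => (j == l)%:R *: y].
rewrite !ffunE; under eq_bigr do rewrite ffunE eactZ.
by rewrite sum_delta.
Qed.

Lemma tight_all X : tight S X.
Proof.
pose b := vbasis (fullv : {vspace X}); pose r := \dim (fullv : {vspace X}).
pose p0 (xi : twisted (diagonal_twist r) regular_module) : X :=
  \sum_i eact ((xi : {ffun 'I_r -> E}) i) (tnth b i).
have p0L : linear p0.
  move=> a x y; rewrite /p0 scaler_sumr -big_split; apply: eq_bigr => i _.
  by rewrite !ffunE eactl.
have p0E : equivariant (mkHom p0L).
  move=> e x; rewrite !mkHomE /p0 eact_sum; apply: eq_bigr => i _.
  by rewrite -eactM; congr (eact _ _); apply: (@eact_diagonal r regular_module e x i).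
apply: (tight_quotient S0 Smax p0E); last exact/tight_twisted/tight_regular.
apply/vspaceP => x; rewrite memvf; apply/memv_imgP.
exists ([ffun i : 'I_r => coord b i x *: one] : {ffun 'I_r -> E}); rewrite ?memvf //.
rewrite mkHomE /p0 {1}(coord_vbasis (memvf x)); apply: eq_bigr => i _.
by rewrite ffunE eact_scale eact1 (tnth_nth 0).
Qed.
End Tight.

(** A rational number p / q all of whose powers have bounded denominator is an
    integer. *)
Lemma coprime_pow_dvd p q D : (0 < D)%N -> coprime p q ->
  (forall m, exists Dm, q ^ m * Dm = p ^ m * D)%N -> q = 1%N.
Proof.
move=> D0 co h.
have qD m : (q ^ m %| D)%N.
  have [Dm e] := h m; rewrite -(@Gauss_dvdr _ (p ^ m)) -?e ?dvdn_mulr //.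
  by rewrite coprimeXl // coprimeXr // coprime_sym.
have q0 : (0 < q)%N.
  by rewrite lt0n; apply: contraTneq (qD 1%N) => ->; rewrite dvd0n -lt0n.
apply/eqP; rewrite eqn_leq q0 andbT leqNgt; apply/negP => q1.
have := dvdn_leq D0 (qD D); rewrite leqNgt; by rewrite ltn_expl.
Qed.

Theorem algebra_dim_dvd : (dimE %| moddim V)%N.
Proof.
have [S [S0 fS0 Smax]] := max_ratio.
have tX := tight_all S0 fS0 Smax.
pose g := gcdn (f S) (moddim S); have g0 : (0 < g)%N by rewrite gcdn_gt0 fS0.
pose p := (f S %/ g)%N; pose q := (moddim S %/ g)%N.
have pE : (f S = p * g)%N by rewrite divnK // dvdn_gcdl.
have qE : (moddim S = q * g)%N by rewrite divnK // dvdn_gcdr.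
have tX' X : (f X * q = p * moddim X)%N.
  apply/eqP; rewrite -(eqn_pmul2r g0) -mulnA -qE tX {1}pE; apply/eqP; lia.
have co : coprime p q.
  by rewrite /coprime -(eqn_pmul2r g0) mul1n -[X in X == _]/((gcdn p q) * g)%N muln_gcdl
      -pE -qE.
have q1 : q = 1%N.
  apply: (coprime_pow_dvd S0 co) => m.
  suff [X e] : exists X : algmod, (q ^ m * moddim X = p ^ m * moddim S)%N by exists
      (moddim X).
  (* Iterating Hom_E(V, -) multiplies the dimension by p / q at each step. *)
  elim: m => [|m [X e]]; first by exists S.
  exists (hom_module X); rewrite moddim_hom_module !expnS.
  have := tX' X; move: (q ^ m)%N (p ^ m)%N e => a c e1 e2.
  transitivity (a * (f X * q))%N; first lia.
  rewrite e2; transitivity (p * (a * moddim X))%N; first lia.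
  rewrite e1; lia.
have [D [dD fD]] := dual_module.
have := tX' D; rewrite q1 muln1 fD dD => ->; exact: dvdn_mull.
Qed.
End Main.
End Ratio.
End Alg.

(** * Sweedler sums *)

(** The sum over t = Σ a ⊗ b of F a b; it depends only on t when F is bilinear, and
    multilinearity is the side condition of every lemma below. *)
Definition sw (k : fieldType) (U W X : lmodType k) (t : (U ⊗ W)%type)
  (F : U -> W -> X) : X := \sum_(p <- terms t) F p.1 p.2.

Notation "\sw_ ( a , b <- t ) F" := (sw t (fun a b => F))
  (at level 41, F at level 41, a name, b name, t at level 50,
   format "'[' \sw_ ( a ,  b  <-  t ) '/  '  F ']'").

Section Sw.
Variable k : fieldType.
Implicit Types U W X Y : lmodType k.

Lemma eq_sw U W X (t : (U ⊗ W)%type) (F G : U -> W -> X) :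
  (forall a b, F a b = G a b) -> sw t F = sw t G.
Proof. by move=> e; apply: eq_bigr => p _. Qed.

Lemma lin_id U : linear (fun x : U => x). Proof. by []. Qed.
Lemma lin_comp U W X (f : {linear W -> X}) (g : U -> W) :
  linear g -> linear (fun x => f (g x)).
Proof. by move=> lg a x y; rewrite lg linearP. Qed.
(** lin_comp is meant for bundled linear maps, lin_comp2 for functions with a
    separate proof of linearity. *)
Lemma lin_comp2 U W X (f : W -> X) (g : U -> W) :
  linear f -> linear g -> linear (fun x => f (g x)).
Proof. by move=> lf lg a x y; rewrite lg lf. Qed.
Lemma lin_scaler U W c (g : U -> W) : linear g -> linear (fun x => c *: g x).
Proof. by move=> lg a x y; rewrite lg scalerDr !scalerA mulrC. Qed.
Lemma lin_scalel U W (g : U -> k^o) (w : W) : linear g -> linear (fun x => g x *: w).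
Proof. by move=> lg a x y; rewrite lg scalerDl scalerA. Qed.
Lemma lin_tensl U W X (g : U -> W) (w : X) : linear g -> linear (fun x => g x ⊗ w).
Proof. by move=> lg a x y; rewrite lg linearPl. Qed.
Lemma lin_tensr U W X (g : U -> W) (w : X) : linear g -> linear (fun x => w ⊗ g x).
Proof. by move=> lg a x y; rewrite lg linearPr. Qed.
Lemma lin_bill U W X Y (f : {bilinear W -> X -> Y}) (g : U -> W) w :
  linear g -> linear (fun x => f (g x) w).
Proof. by move=> lg a x y; rewrite lg linearPl. Qed.
Lemma lin_bilr U W X Y (f : {bilinear W -> X -> Y}) (g : U -> X) w :
  linear g -> linear (fun x => f w (g x)).
Proof. by move=> lg a x y; rewrite lg linearPr. Qed.
Lemma lin_mull U (A : algType k) (g : U -> A) c : linear g -> linear (fun x => g x * c).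
Proof. by move=> lg a x y; rewrite lg mulrDl scalerAl. Qed.
Lemma lin_mulr U (A : algType k) (g : U -> A) c : linear g -> linear (fun x => c * g x).
Proof. by move=> lg a x y; rewrite lg mulrDr scalerAr. Qed.
Lemma lin_sum U W I (r : seq I) P (F : U -> I -> W) :
  (forall i, linear (F^~ i)) -> linear (fun x => \sum_(i <- r | P i) F x i).
Proof.
move=> lF a x y; rewrite scaler_sumr -big_split; apply: eq_bigr => i _; exact: lF.
Qed.
Lemma lin_sw U W X Y (t : (U ⊗ W)%type) (F : Y -> U -> W -> X) :
  (forall a b, linear (fun x => F x a b)) -> linear (fun x => sw t (F x)).
Proof. by move=> lF; apply: lin_sum => p; apply: lF. Qed.

Definition bil U W X (F : U -> W -> X) :=
  (forall w, linear (fun u => F u w)) /\ (forall u, linear (F u)).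

Definition mkbil U W X (F : U -> W -> X) (bF : bil F) : {bilinear U -> W -> X} :=
  HB.pack F (bilinear_isBilinear.Build k U W X *:%R *:%R F
   ((fun w => (bF.1 w : linear_for *:%R (applyr F w))), bF.2)).

Lemma sw_linear U W X (F : U -> W -> X) : bil F -> linear (fun t => sw t F).
Proof. by move=> bF; exact: (sum_terms_is_linear (mkbil bF)). Qed.

Lemma sw_tens U W X (F : U -> W -> X) u w : bil F -> sw (u ⊗ w) F = F u w.
Proof. by move=> bF; exact: (sum_terms_tens (mkbil bF)). Qed.

Lemma lin_sw_arg U W X Y (g : Y -> (U ⊗ W)%type) (F : U -> W -> X) :
  linear g -> bil F -> linear (fun x => sw (g x) F).
Proof. by move=> lg bF a x y; rewrite lg; apply: sw_linear. Qed.

Lemma lin0 U W (g : U -> W) : linear g -> g 0 = 0.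
Proof. by move=> lg; exact: (linear0 (mklin lg)). Qed.
Lemma linD U W (g : U -> W) x y : linear g -> g (x + y) = g x + g y.
Proof. by move=> lg; exact: (linearD (mklin lg)). Qed.
Lemma linZ U W (g : U -> W) a x : linear g -> g (a *: x) = a *: g x.
Proof. by move=> lg; exact: (linearZ_LR (mklin lg)). Qed.
Lemma lin_bigsum U W (g : U -> W) I (r : seq I) (P : pred I) F : linear g ->
  g (\sum_(i <- r | P i) F i) = \sum_(i <- r | P i) g (F i).
Proof. by move=> lg; exact: (linear_sum (mklin lg)). Qed.

Lemma sw_sum U W X I (r : seq I) (P : pred I) (T : I -> (U ⊗ W)%type) (F : U -> W -> X) :
  bil F -> sw (\sum_(i <- r | P i) T i) F = \sum_(i <- r | P i) sw (T i) F.
Proof. by move=> bF; apply: (lin_bigsum (g := fun t => sw t F)); apply: sw_linear. Qed.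

Lemma lin_of_sw U W X Y (g : X -> Y) (t : (U ⊗ W)%type) F : linear g ->
  g (sw t F) = sw t (fun a b => g (F a b)).
Proof. exact: lin_bigsum. Qed.

Lemma sw_exchange U W U' W' X (t : (U ⊗ W)%type) (s : (U' ⊗ W')%type)
  (F : U -> W -> U' -> W' -> X) :
  \sw_(a, b <- t) \sw_(c, d <- s) F a b c d =
  \sw_(c, d <- s) \sw_(a, b <- t) F a b c d.
Proof. exact: exchange_big. Qed.

Lemma sw_id U W (t : (U ⊗ W)%type) : \sw_(a, b <- t) a ⊗ b = t.
Proof. exact: tens_terms. Qed.

End Sw.

Definition tril (k : fieldType) (X U W Z : lmodType k) (F : U -> W -> Z -> X) :=
  [/\ forall b c, linear (fun a => F a b c), forall a c, linear (fun b => F a b c)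
   & forall a b, linear (F a b)].

Lemma lin_counit (k : fieldType) (H : hopfAlgType k) (U W : lmodType k)
  (g : U -> H) (w : W) : linear g -> linear (fun x => counit (g x) *: w).
Proof. by move=> lg a x y; rewrite lg linearP scalerDl scalerA. Qed.

Lemma lin_bil1 (k : fieldType) (U W X Y : lmodType k) (F : U -> W -> X) (g : Y -> U) w :
  bil F -> linear g -> linear (fun x => F (g x) w).
Proof. by case=> F1 _ lg; apply: (lin_comp2 (F1 w) lg). Qed.
Lemma lin_bil2 (k : fieldType) (U W X Y : lmodType k) (F : U -> W -> X) (g : Y -> W) w :
  bil F -> linear g -> linear (fun x => F w (g x)).
Proof. by case=> _ F2 lg; apply: (lin_comp2 (F2 w) lg). Qed.
Lemma lin_tri1 (k : fieldType) (U W Z X Y : lmodType k) (F : U -> W -> Z -> X) (g : Y ->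
    U) w z :
  tril F -> linear g -> linear (fun x => F (g x) w z).
Proof. by case=> F1 _ _ lg; apply: (lin_comp2 (F1 w z) lg). Qed.
Lemma lin_tri2 (k : fieldType) (U W Z X Y : lmodType k) (F : U -> W -> Z -> X) (g : Y ->
    W) w z :
  tril F -> linear g -> linear (fun x => F w (g x) z).
Proof. by case=> _ F1 _ lg; apply: (lin_comp2 (F1 w z) lg). Qed.
Lemma lin_tri3 (k : fieldType) (U W Z X Y : lmodType k) (F : U -> W -> Z -> X) (g : Y ->
    Z) w z :
  tril F -> linear g -> linear (fun x => F w z (g x)).
Proof. by case=> _ _ F1 lg; apply: (lin_comp2 (F1 w z) lg). Qed.

(** The tactic lin proves linearity, bilinearity and trilinearity of expressions
    built from products, actions, tensors and nested Sweedler sums. *)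
Ltac lin_hyp := match goal with
  | h : bil ?F |- linear (?F ?w) => exact: (h.2 w)
  | h : tril ?F |- linear (?F ?w ?z) => exact: (lin_tri3 w z h (@lin_id _ _))
  | h : linear ?F |- linear (fun x => ?F _) => apply: (lin_comp2 h)
  | h : bil ?F |- linear (fun x => ?F _ ?w) => apply: (lin_bil1 w h)
  | h : bil ?F |- linear (fun x => ?F ?w _) => apply: (lin_bil2 w h)
  | h : tril ?F |- linear (fun x => ?F _ ?w ?z) => apply: (lin_tri1 w z h)
  | h : tril ?F |- linear (fun x => ?F ?w _ ?z) => apply: (lin_tri2 w z h)
  | h : tril ?F |- linear (fun x => ?F ?w ?z _) => apply: (lin_tri3 w z h)
  end.

Ltac lin1 := first [
    assumption | exact: lin_id | lin_hyp | apply: lin_tensl | apply: lin_tensr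
  | apply: lin_mull | apply: lin_mulr | apply: lin_scaler | apply: lin_scalel
  | apply: lin_counit
  | apply: lin_comp | apply: lin_bill | apply: lin_bilr
  | (apply: lin_sw => ? ?)
  | apply: lin_sw_arg | (apply: lin_sum => ?)
  | (split; [move=> ? ? | move=> ? ? | move=> ? ?])
  | (split=> ?) ].
Ltac lin := repeat lin1.

Lemma sw3 (k : fieldType) (X U W Z : lmodType k) (F : U -> W -> Z -> X) :
  tril F -> bil (fun u (s : (W ⊗ Z)%type) => sw s (F u)).
Proof. by case=> l1 l2 l3; split=> ?; lin. Qed.

Section Hopf.
Variables (k : fieldType) (H : hopfAlgType k).
Local Notation S := (antipode : H -> H).
Local Notation D := (comul : H -> (H ⊗ H)%type).
Local Notation e := (counit : H -> k).

Section Functional.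
Variable X : lmodType k.

Lemma coassoc (x : H) (F : H -> H -> H -> X) : tril F ->
  \sw_(a, b <- D x) \sw_(c, d <- D b) F a c d =
  \sw_(a, b <- D x) \sw_(c, d <- D a) F c d b.
Proof.
move=> tF; have b3 := sw3 tF; case: (tF) => l1 l2 l3.
have /(congr1 (fun t => sw t (fun u s => sw s (F u)))) := comulA x.
rewrite !(sw_sum _ _ _ b3) => e1.
transitivity (\sum_(p <- terms (D x)) sw (\sum_(q <- terms (D p.2)) p.1 ⊗ (q.1 ⊗ q.2))
    (fun u s => sw s (F u))).
  apply: eq_bigr => p _; rewrite (sw_sum _ _ _ b3); apply: eq_bigr => q _.
  by rewrite sw_tens // sw_tens //; split.
rewrite e1; apply: eq_bigr => p _; rewrite (sw_sum _ _ _ b3); apply: eq_bigr => q _.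
by rewrite sw_tens // sw_tens //; split.
Qed.

Lemma counit_l (x : H) (F : H -> X) : linear F ->
  \sw_(a, b <- D x) e a *: F b = F x.
Proof.
move=> lF; rewrite -[in RHS](counitl x) (lin_bigsum _ _ _ lF).
by apply: eq_bigr => p _; rewrite (linZ _ _ lF).
Qed.

Lemma counit_r (x : H) (F : H -> X) : linear F ->
  \sw_(a, b <- D x) e b *: F a = F x.
Proof.
move=> lF; rewrite -[in RHS](counitr x) (lin_bigsum _ _ _ lF).
by apply: eq_bigr => p _; rewrite (linZ _ _ lF).
Qed.

Lemma antipode_l (x : H) (F : H -> X) : linear F ->
  \sw_(a, b <- D x) F (S a * b) = e x *: F 1.
Proof. by move=> lF; rewrite -(linZ _ _ lF) -antipodel (lin_bigsum _ _ _ lF). Qed.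

Lemma antipode_r (x : H) (F : H -> X) : linear F ->
  \sw_(a, b <- D x) F (a * S b) = e x *: F 1.
Proof. by move=> lF; rewrite -(linZ _ _ lF) -antipoder (lin_bigsum _ _ _ lF). Qed.

Lemma sw_comul1 (F : H -> H -> X) : bil F -> sw (D 1) F = F 1 1.
Proof. by move=> bF; rewrite comul1 sw_tens. Qed.

Lemma sw_comulM (x y : H) (F : H -> H -> X) : bil F ->
  sw (D (x * y)) F = \sw_(a, b <- D x) \sw_(c, d <- D y) F (a * c) (b * d).
Proof.
move=> bF; rewrite comulM /tmul sw_sum //; apply: eq_bigr => p _.
by rewrite sw_sum //; apply: eq_bigr => q _; rewrite sw_tens.
Qed.
End Functional.

Lemma antipode1 : S 1 = 1.
Proof.
have := antipodel (1 : H); rewrite -/(sw (D 1) (fun a b => S a * b)) sw_comul1; last by lin.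
by rewrite mulr1 rmorph1 scale1r.
Qed.

Lemma counit_antipode x : e (S x) = e x.
Proof.
have h : \sw_(a, b <- D x) e b *: (e (S a) : k^o) = e (S x).
  by apply: (counit_r x (F := fun a => e (S a) : k^o)) => a y z; rewrite !linearP.
rewrite -h; have := congr1 e (antipodel x); rewrite linear_sum linearZ /= rmorph1 mulr1
    => <-.
by apply: eq_bigr => p _; rewrite rmorphM /= mulrC.
Qed.

(** (x, y) |-> S(xy) is a left convolution inverse of the product and
    (x, y) |-> S(y) S(x) a right one; the sum Z is their common value. *)
Lemma antipodeM x y : S (x * y) = S y * S x.
Proof.
pose Z := \sw_(a, b <- D x) \sw_(c, d <- D y) \sw_(b1, b2 <- D b) \sw_(d1, d2 <- D d)
  S (a * c) * (b1 * d1) * (S d2 * S b2).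
transitivity Z.
  transitivity (\sw_(a, b <- D x) e b *: S (a * y)).
    by rewrite counit_r //; lin.
  apply: eq_sw => a b.
  transitivity (\sw_(c, d <- D y) e d *: (e b *: S (a * c))).
    by rewrite counit_r //; lin.
  apply: eq_sw => c d.
  transitivity (\sw_(b1, b2 <- D b) e d *: (S (a * c) * (b1 * S b2))).
    rewrite (antipode_r b (F := fun t => e d *: (S (a * c) * t))) ?mulr1; last by lin.
    by rewrite !scalerA mulrC.
  apply: eq_sw => b1 b2.
  transitivity (\sw_(d1, d2 <- D d) S (a * c) * (b1 * (d1 * S d2) * S b2)).
    rewrite (antipode_r d (F := fun t => S (a * c) * (b1 * t * S b2))) ?mulr1 //; lin.
  by apply: eq_sw => d1 d2; rewrite !mulrA.
transitivity (\sw_(a, b <- D x) \sw_(p, q <- D a) \sw_(c, d <- D y) \sw_(r, s <- D c)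
   S (p * r) * (q * s) * (S d * S b)).
  rewrite -(coassoc x (F := fun p q b => \sw_(c, d <- D y) \sw_(r, s <- D c)
   S (p * r) * (q * s) * (S d * S b))); last by lin.
  apply: eq_sw => a b; rewrite sw_exchange; apply: eq_sw => b1 b2.
  by rewrite -(coassoc y (F := fun r s d =>  S (a * r) * (b1 * s) * (S d * S b2))) //; lin.
transitivity (\sw_(a, b <- D x) e a *: (S y * S b)); last by rewrite counit_l //; lin.
apply: eq_sw => a b; rewrite sw_exchange.
transitivity (\sw_(c, d <- D y) e c *: (e a *: (S d * S b))); last by rewrite counit_l
    //; lin.
apply: eq_sw => c d.
rewrite -(sw_comulM a c (F := fun u v => S u * v * (S d * S b))); last by lin.
rewrite (antipode_l _ (F := fun t => t * (S d * S b))); last by lin.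
by rewrite mul1r rmorphM scalerA mulrC.
Qed.

(** Both sides are convolution inverses of the coproduct. *)
Lemma comul_antipode (X : lmodType k) (x : H) (F : H -> H -> X) : bil F ->
  sw (D (S x)) F = \sw_(a, b <- D x) F (S b) (S a).
Proof.
move=> bF.
transitivity (\sw_(a, b <- D x) \sw_(p, q <- D (S a)) \sw_(b', b'' <- D b)
  \sw_(c, d <- D b') \sw_(g, h <- D b'') F (p * (c * S h)) (q * (d * S g))).
  transitivity (\sw_(a, b <- D x) e b *: sw (D (S a)) F).
    by rewrite counit_r //; lin.
  apply: eq_sw => a b; rewrite (lin_of_sw (g := fun t => e b *: t)); last by lin.
  apply: eq_sw => p q.
  transitivity (\sw_(c, w <- D b) \sw_(m, h <- D w) \sw_(d, g <- D m) F (p * (c * S h))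
      (q * (d * S g))).
    transitivity (\sw_(c, w <- D b) F (p * (c * S w)) q).
      by rewrite (antipode_r b (F := fun t => F (p * t) q)) ?mulr1 //; lin.
    apply: eq_sw => c w.
    transitivity (\sw_(m, h <- D w) e m *: F (p * (c * S h)) q).
      by rewrite (counit_l w (F := fun h => F (p * (c * S h)) q)) //; lin.
    apply: eq_sw => m h.
    by rewrite (antipode_r m (F := fun t => F (p * (c * S h)) (q * t))) ?mulr1 //; lin.
  rewrite -(coassoc b (F := fun c d v => \sw_(g, h <- D v) F (p * (c * S h)) (q * (d * S
      g)))); last by lin.
  apply: eq_sw => c w.
  by rewrite -(coassoc w (F := fun d g h => F (p * (c * S h)) (q * (d * S g)))) //; lin.
transitivity (\sw_(a, b <- D x) \sw_(a', a'' <- D a) \sw_(p, q <- D (S a'))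
  \sw_(c, d <- D a'') \sw_(g, h <- D b) F (p * (c * S h)) (q * (d * S g))).
  rewrite -(coassoc x (F := fun a' a'' b => \sw_(p, q <- D (S a'))
  \sw_(c, d <- D a'') \sw_(g, h <- D b) F (p * (c * S h)) (q * (d * S g)))); last by lin.
  by apply: eq_sw => a b; rewrite sw_exchange.
transitivity (\sw_(a, b <- D x) e a *: \sw_(g, h <- D b) F (S h) (S g)).
  apply: eq_sw => a b.
  transitivity (\sw_(a', a'' <- D a) \sw_(p, q <- D (S a' * a'')) \sw_(g, h <- D b) F (p
      * S h) (q * S g)).
    apply: eq_sw => a' a''; rewrite sw_comulM; last by lin.
    by do 3! (apply: eq_sw => ? ?); rewrite !mulrA.
  rewrite (antipode_l a (F := fun t => \sw_(p, q <- D t) \sw_(g, h <- D b) F (p * S h) (q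
      * S g))); last by lin.
  rewrite sw_comul1; last by lin.
  by congr (_ *: _); apply: eq_sw => g h; rewrite !mul1r.
by rewrite (counit_l x (F := fun b => \sw_(g, h <- D b) F (S h) (S g))) //; lin.
Qed.
End Hopf.

(** * Quasi-triangular structures *)

(** swap_at n exchanges the n-th and the (n+1)-st of a tower of Sweedler sums. *)
Ltac under_sw n := lazymatch n with
  | O => idtac
  | Datatypes.S ?m => apply: eq_sw; intros ? ?; under_sw m
  end.
Tactic Notation "swap_at" constr(n) :=
  refine (etrans _ _); [under_sw n; apply: sw_exchange |]; cbv beta.

Section QuasiTriangular.
Variables (k : fieldType) (H : hopfAlgType k) (R : (H ⊗ H)%type).
Hypothesis qt : quasi_triangular R.
Local Notation S := (antipode : H -> H).
Local Notation D := (comul : H -> (H ⊗ H)%type).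
Local Notation e := (counit : H -> k).

Section Functional.
Variable X : lmodType k.

Lemma hexagon_l (F : H -> H -> H -> X) : tril F ->
  \sw_(r, s <- R) \sw_(a, b <- D r) F a b s =
  \sw_(r, s <- R) \sw_(r', s' <- R) F r r' (s * s').
Proof.
move=> tF; have b3 := sw3 tF; case: qt => _ _ /(congr1 (fun t => sw t (fun u s => sw s (F
    u)))) h _.
move: h; rewrite !(sw_sum _ _ _ b3) => h; refine (etrans _ _); [refine (etrans _ _);
    [|exact: h]|].
  apply: eq_bigr => p _; rewrite (sw_sum _ _ _ b3); apply: eq_bigr => q _.
  by rewrite sw_tens // sw_tens //; lin.
apply: eq_bigr => p _; rewrite (sw_sum _ _ _ b3); apply: eq_bigr => q _.
by rewrite sw_tens // sw_tens //; lin.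
Qed.

Lemma hexagon_r (F : H -> H -> H -> X) : tril F ->
  \sw_(r, s <- R) \sw_(a, b <- D s) F r a b =
  \sw_(r, s <- R) \sw_(r', s' <- R) F (r * r') s' s.
Proof.
move=> tF; have b3 := sw3 tF; case: qt => _ _ _ /(congr1 (fun t => sw t (fun u s => sw s
    (F u)))) h.
move: h; rewrite !(sw_sum _ _ _ b3) => h; refine (etrans _ _); [refine (etrans _ _);
    [|exact: h]|].
  apply: eq_bigr => p _; rewrite (sw_sum _ _ _ b3); apply: eq_bigr => q _.
  by rewrite sw_tens // sw_tens //; lin.
apply: eq_bigr => p _; rewrite (sw_sum _ _ _ b3); apply: eq_bigr => q _.
by rewrite sw_tens // sw_tens //; lin.
Qed.

Lemma R_intertwines h (F : H -> H -> X) : bil F ->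
  \sw_(r, s <- R) \sw_(a, b <- D h) F (r * a) (s * b) =
  \sw_(r, s <- R) \sw_(a, b <- D h) F (b * r) (a * s).
Proof.
move=> bF; case: qt => _ /(_ h)/(congr1 (fun t => sw t F)) e1 _ _.
move: e1; rewrite !sw_sum // => e1; refine (etrans _ _); [refine (etrans _ _); [|exact:
    e1]|].
  by apply: eq_bigr => p _; rewrite sw_sum //; apply: eq_bigr => q _; rewrite sw_tens.
by apply: eq_bigr => p _; rewrite sw_sum //; apply: eq_bigr => q _; rewrite sw_tens.
Qed.
End Functional.

Lemma sw_tmul (X : lmodType k) (x y : (H ⊗ H)%type) (F : H -> H -> X) : bil F ->
  sw (tmul x y) F = \sw_(a, b <- x) \sw_(c, d <- y) F (a * c) (b * d).
Proof.
move=> bF; rewrite /tmul sw_sum //; apply: eq_bigr => p _.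
by rewrite sw_sum //; apply: eq_bigr => q _; rewrite sw_tens.
Qed.

(** Applying ε to the first hexagon identity gives R = (1 ⊗ g) R with
    g = ε(R^1) R^2; cancelling R gives g = 1. *)
Lemma counitR_l (X : lmodType k) (F : H -> X) : linear F ->
  \sw_(r, s <- R) e r *: F s = F 1.
Proof.
have [[Q [RQ _]] _ _ _] := qt.
pose g : H := \sw_(r, s <- R) e r *: s.
have gR (Y : lmodType k) (G : H -> H -> Y) : bil G ->
    \sw_(r, s <- R) G r (g * s) = \sw_(r, s <- R) G r s.
  move=> bG; transitivity (\sw_(r, s <- R) \sw_(a, b <- D r) e a *: G b s); last first.
    by apply: eq_sw => r s; rewrite (counit_l r (F := fun b => G b s)) //; lin.
  rewrite (hexagon_l (F := fun a b s => e a *: G b s)); last by lin.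
  rewrite sw_exchange; apply: eq_sw => r s.
  rewrite /g (lin_of_sw (g := fun t => G r (t * s))); last by lin.
  by apply: eq_sw => a b; rewrite -scalerAl (linZ (g := G r)) //; lin.
suff g1 : g = 1.
  move=> lF; rewrite -g1 /g (lin_of_sw (g := F)) //.
  by apply: eq_sw => r s; rewrite (linZ (g := F)).
have b0 : bil (fun r s : H => e r *: s) by lin.
have h1 : sw (tmul R Q) (fun r s => e r *: s) = 1.
  by rewrite RQ sw_tens // rmorph1 scale1r.
rewrite -[RHS]h1 sw_tmul // -(gR _ (fun r s => \sw_(c, d <- Q) e (r * c) *: (s * d)));
    last by lin.
rewrite -[LHS]mulr1 -h1 sw_tmul // (lin_of_sw (g := fun t => g * t)); last by lin.
apply: eq_sw => r s; rewrite (lin_of_sw (g := fun t => g * t)); last by lin.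
by apply: eq_sw => c d; rewrite -scalerAr mulrA.
Qed.

Lemma counitR_r (X : lmodType k) (F : H -> X) : linear F ->
  \sw_(r, s <- R) e s *: F r = F 1.
Proof.
have [[Q [RQ _]] _ _ _] := qt.
pose g : H := \sw_(r, s <- R) e s *: r.
have gR (Y : lmodType k) (G : H -> H -> Y) : bil G ->
    \sw_(r, s <- R) G (g * r) s = \sw_(r, s <- R) G r s.
  move=> bG; transitivity (\sw_(r, s <- R) \sw_(a, b <- D s) e b *: G r a); last first.
    by apply: eq_sw => r s; rewrite (counit_r s (F := fun b => G r b)) //; lin.
  rewrite (hexagon_r (F := fun r a b => e b *: G r a)); last by lin.
  rewrite sw_exchange; apply: eq_sw => r s.
  rewrite /g (lin_of_sw (g := fun t => G (t * r) s)); last by lin.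
  by apply: eq_sw => a b; rewrite -scalerAl (linZ (g := fun t => G t s)) //; lin.
suff g1 : g = 1.
  move=> lF; rewrite -g1 /g (lin_of_sw (g := F)) //.
  by apply: eq_sw => r s; rewrite (linZ (g := F)).
have b0 : bil (fun r s : H => e s *: r) by lin.
have h1 : sw (tmul R Q) (fun r s => e s *: r) = 1.
  by rewrite RQ sw_tens // rmorph1 scale1r.
rewrite -[RHS]h1 sw_tmul // -(gR _ (fun r s => \sw_(c, d <- Q) e (s * d) *: (r * c)));
    last by lin.
rewrite -[LHS]mulr1 -h1 sw_tmul // (lin_of_sw (g := fun t => g * t)); last by lin.
apply: eq_sw => r s; rewrite (lin_of_sw (g := fun t => g * t)); last by lin.
by apply: eq_sw => c d; rewrite -scalerAr mulrA.
Qed.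

Section Functional2.
Variables (X : lmodType k) (F : H -> H -> X).
Hypothesis bF : bil F.

Lemma antipodeR_l : \sw_(r, s <- R) \sw_(p, q <- R) F (S r * p) (s * q) = F 1 1.
Proof.
rewrite -(hexagon_l (F := fun a b s => F (S a * b) s)); last by lin.
rewrite -[RHS](counitR_l (F := fun s => F 1 s)); last by lin.
by apply: eq_sw => r s; rewrite (antipode_l r (F := fun t => F t s)) //; lin.
Qed.

Lemma antipodeR_rr : \sw_(r, s <- R) \sw_(p, q <- R) F (r * p) (q * S s) = F 1 1.
Proof.
rewrite -(hexagon_r (F := fun r a b => F r (a * S b))); last by lin.
rewrite -[RHS](counitR_r (F := fun s => F s 1)); last by lin.
by apply: eq_sw => r s; rewrite (antipode_r s (F := fun t => F r t)) //; lin.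
Qed.

Lemma antipodeR_rl : \sw_(r, s <- R) \sw_(p, q <- R) F (r * p) (S q * s) = F 1 1.
Proof.
rewrite -(hexagon_r (F := fun r a b => F r (S a * b))); last by lin.
rewrite -[RHS](counitR_r (F := fun s => F s 1)); last by lin.
by apply: eq_sw => r s; rewrite (antipode_l s (F := fun t => F r t)) //; lin.
Qed.
End Functional2.

(** R^{-1} = S(R^1) ⊗ R^2: by antipodeR_l this is a left inverse, hence it agrees
    with the given two-sided inverse Q. *)
Lemma antipodeR_lr (X : lmodType k) (F : H -> H -> X) : bil F ->
  \sw_(r, s <- R) \sw_(p, q <- R) F (r * S p) (s * q) = F 1 1.
Proof.
move=> bF; have [[Q [RQ _]] _ _ _] := qt.
have QS (Y : lmodType k) (G : H -> H -> Y) : bil G ->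
    \sw_(p, q <- R) G (S p) q = sw Q G.
  move=> bG.
  transitivity (\sw_(p, q <- R) \sw_(r, s <- R) \sw_(x, y <- Q) G (S p * (r * x)) (q * (s
      * y))).
    apply: eq_sw => p q; rewrite -(sw_tmul R Q (F := fun a b => G (S p * a) (q * b)));
        last by lin.
    by rewrite RQ sw_tens ?mulr1 //; lin.
  transitivity (\sw_(x, y <- Q) \sw_(p, q <- R) \sw_(r, s <- R) G (S p * r * x) (q * s *
      y)).
    swap_at 1%N; swap_at 0%N; do 3! (apply: eq_sw => ? ?); by rewrite !mulrA.
  by apply: eq_sw => x y; rewrite (antipodeR_l (F := fun a b => G (a * x) (b * y)))
      ?mul1r //; lin.
transitivity (\sw_(r, s <- R) \sw_(p, q <- Q) F (r * p) (s * q)).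
  by apply: eq_sw => r s; rewrite (QS _ (fun p q => F (r * p) (s * q))) //; lin.
by rewrite -sw_tmul // RQ sw_tens.
Qed.

(** (S ⊗ S)(R) is a right inverse of S(R^1) ⊗ R^2 = R^{-1}, so it is R. *)
Lemma R_antipode (X : lmodType k) (F : H -> H -> X) : bil F ->
  \sw_(r, s <- R) F (S r) (S s) = sw R F.
Proof.
move=> bF; transitivity (\sw_(t, u <- R) \sw_(r, s <- R) \sw_(p, q <- R) F (r * S p * S
    t) (s * q * S u)).
  apply: eq_sw => t u.
  by rewrite (antipodeR_lr (F := fun a b => F (a * S t) (b * S u))) ?mul1r //; lin.
swap_at 0%N; apply: eq_sw => r s.
transitivity (\sw_(t, u <- R) \sw_(p, q <- R) F (r * S (t * p)) (s * (q * S u))).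
  by do 2! (apply: eq_sw => ? ?); rewrite antipodeM !mulrA.
rewrite (antipodeR_rr (F := fun a b => F (r * S a) (s * b))) ?antipode1 ?mulr1 //; lin.
Qed.

(** The Drinfeld element, which conjugates the antipode squared; this makes S
    invertible before finite-dimensionality of H is known. *)
Definition drinfeld : H := \sw_(r, s <- R) S s * r.
Definition drinfeld_inv : H := \sw_(r, s <- R) s * S (S r).
Local Notation u := drinfeld.
Local Notation w := drinfeld_inv.

Lemma drinfeld_conj h : u * h = S (S h) * u.
Proof.
transitivity (\sw_(a, b <- D h) \sw_(c, d <- D a) \sw_(r, s <- R) S (S b) * (S (s * d) *
    (r * c))).
  rewrite -(coassoc h (F := fun c d b => \sw_(r, s <- R) S (S b) * (S (s * d) * (r *
      c)))); last by lin.
  transitivity (\sw_(c, b <- D h) e b *: (u * c)).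
    by rewrite (counit_r h (F := fun c => u * c)) //; lin.
  apply: eq_sw => c v; rewrite /u (lin_of_sw (g := fun t => e v *: (t * c))); last by lin.
  rewrite sw_exchange; apply: eq_sw => r s.
  transitivity (\sw_(d, b <- D v) S (d * S b) * (S s * (r * c))).
    rewrite (antipode_r v (F := fun t => S t * (S s * (r * c)))); last by lin.
    by rewrite antipode1 mul1r mulrA.
  by apply: eq_sw => d b; rewrite !antipodeM !mulrA.
transitivity (\sw_(a, b <- D h) e a *: (S (S b) * u)); last first.
  by rewrite (counit_l h (F := fun b => S (S b) * u)) //; lin.
apply: eq_sw => a b; rewrite sw_exchange.
rewrite (R_intertwines a (F := fun x y => S (S b) * (S y * x))); last by lin.
rewrite /u (lin_of_sw (g := fun t => e a *: (S (S b) * t))); last by lin.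
apply: eq_sw => r s.
transitivity (\sw_(c, d <- D a) S (S b) * (S s * (S c * d) * r)).
  by apply: eq_sw => c d; rewrite antipodeM !mulrA.
by rewrite (antipode_l a (F := fun t => S (S b) * (S s * t * r))) ?mulr1 //; lin.
Qed.

Lemma drinfeldV : u * w = 1.
Proof.
rewrite /w (lin_of_sw (g := fun t => u * t)); last by lin.
transitivity (\sw_(r, s <- R) \sw_(p, q <- R) S (q * S s) * (p * S (S r))).
  apply: eq_sw => r s; rewrite mulrA drinfeld_conj /u.
  rewrite (lin_of_sw (g := fun t => S (S s) * t * S (S r))); last by lin.
  by apply: eq_sw => p q; rewrite antipodeM !mulrA.
rewrite (R_antipode (F := fun x y => \sw_(p, q <- R) S (q * y) * (p * S x))); last by lin.
rewrite sw_exchange (antipodeR_lr (F := fun x y => S y * x)); last by lin.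
by rewrite antipode1 mulr1.
Qed.

(** Conjugating u w = 1 by u. *)
Lemma drinfeldVl : S (S w) * u = 1.
Proof. by rewrite -drinfeld_conj drinfeldV. Qed.

Lemma antipode_inj : injective S.
Proof.
move=> x y e1; rewrite -[x]mul1r -[y]mul1r -drinfeldVl -!mulrA.
by rewrite !drinfeld_conj e1.
Qed.

(** S^{-1}(h) = u^{-1} S(h) u, as S^2 is conjugation by u. *)
Definition antipode_inv h : H := w * S h * u.
Local Notation S' := antipode_inv.

Lemma antipode_invK h : S (S' h) = h.
Proof.
apply: antipode_inj; rewrite -[LHS]mulr1 -[RHS]mulr1 -drinfeldV !mulrA -drinfeld_conj.
by rewrite /S' !mulrA drinfeldV mul1r.
Qed.

Lemma antipode_inv_linear : linear S'.
Proof. by rewrite /S'; lin. Qed.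

Lemma antipode_inv_l (X : lmodType k) h (F : H -> X) : linear F ->
  \sw_(a, b <- D h) F (b * S' a) = e h *: F 1.
Proof.
move=> lF; rewrite -(lin_of_sw (g := F)) // -(linZ _ _ lF); congr F.
apply: antipode_inj; rewrite linearZ /= antipode1 -antipoder linear_sum.
by apply: eq_bigr => p _; rewrite antipodeM antipode_invK.
Qed.

Section AlmostTriangular.
Hypothesis central : tensor_of (@center k H) (@center k H) (tmul (flip R) R).
Local Notation S' := antipode_inv.

(** R21 R. *)
Definition monodromy : (H ⊗ H)%type := tmul (flip R) R.
Local Notation z := monodromy.

Lemma sw_monodromy (X : lmodType k) (F : H -> H -> X) : bil F ->
  \sw_(r, s <- R) \sw_(p, q <- R) F (s * p) (r * q) = sw z F.
Proof.
move=> bF; rewrite /z sw_tmul // /flip sw_sum; last by lin.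
by apply: eq_bigr => p _; rewrite sw_tens //; lin.
Qed.

Lemma center_antipode c : @center k H c -> @center k H (S c).
Proof. by move=> Zc h; rewrite -[h](antipode_invK) -!antipodeM Zc. Qed.

Lemma sw_central (X : lmodType k) (F G : H -> H -> X) : bil F -> bil G ->
  (forall a b, @center k H a -> @center k H b -> F a b = G a b) ->
  sw z F = sw z G.
Proof.
move=> bF bG FG; have [s sz zE] := central; rewrite /z zE !sw_sum //.
by rewrite !big_seq; apply: eq_bigr => p /sz[Z1 Z2]; rewrite !sw_tens // FG.
Qed.

(** The two hexagon identities give (id ⊗ Δ)(R21 R) = R21 R31 R13 R12; the inner
    pair R31 R13 is central and can be moved out. *)
Lemma monodromy_comul (X : lmodType k) (F : H -> H -> H -> X) : tril F ->
  \sw_(a, b <- z) \sw_(b1, b2 <- D b) F a b1 b2 =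
  \sw_(a, b <- z) \sw_(a', b' <- z) F (a * a') b' b.
Proof.
move=> tF; rewrite -(sw_monodromy (F := fun a b => \sw_(b1, b2 <- D b) F a b1 b2)); last
    by lin.
transitivity (\sw_(r, s <- R) \sw_(r1, r2 <- D r) \sw_(p, q <- R) \sw_(q1, q2 <- D q)
   F (s * p) (r1 * q1) (r2 * q2)).
  apply: eq_sw => r s; rewrite sw_exchange; apply: eq_sw => p q.
  by rewrite sw_comulM //; lin.
rewrite (hexagon_l (F := fun r1 r2 s => \sw_(p, q <- R) \sw_(q1, q2 <- D q)
   F (s * p) (r1 * q1) (r2 * q2))); last by lin.
transitivity (\sw_(r, s <- R) \sw_(r', s' <- R) \sw_(p, q <- R) \sw_(p', q' <- R)
   F (s * (s' * p) * p') (r * q') (r' * q)).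
  do 2!(apply: eq_sw => ? ?).
  rewrite (hexagon_r (F := fun p q1 q2 => F (_ * _ * p) (_ * q1) (_ * q2))); last by lin.
  by do 2!(apply: eq_sw => ? ?); rewrite !mulrA.
transitivity (\sw_(r, s <- R) \sw_(p', q' <- R) \sw_(a, b <- z)
   F (a * (s * p')) (r * q') b).
  apply: eq_sw => r s; swap_at 1%N; swap_at 0%N; apply: eq_sw => p' q'.
  rewrite (sw_monodromy (F := fun a b => F (s * a * p') (r * q') b)); last by lin.
  by apply: sw_central; [lin|lin|move=> a b Za _; rewrite -Za -mulrA].
swap_at 1%N; swap_at 0%N; apply: eq_sw => a b.
by rewrite (sw_monodromy (F := fun x y => F (a * x) y b)) //; lin.
Qed.

(** Contracting monodromy_comul with the antipode. *)
Lemma monodromy_antipode (X : lmodType k) (F : H -> H -> X) : bil F ->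
  \sw_(a, b <- z) \sw_(a', b' <- z) F (a * a') (S b * b') = F 1 1.
Proof.
move=> bF; transitivity (\sw_(a, b <- z) \sw_(a', b' <- z) F (a * a') (S b' * b)).
  rewrite [RHS]sw_exchange; apply: eq_sw => a b.
  by apply: sw_central; [lin|lin|move=> a' b' Za _; rewrite -Za].
rewrite -(monodromy_comul (F := fun a b b' => F a (S b * b'))); last by lin.
transitivity (\sw_(a, b <- z) e b *: F a 1).
  by apply: eq_sw => a b; rewrite (antipode_l b (F := fun t => F a t)) //; lin.
rewrite -(sw_monodromy (F := fun a b => e b *: F a 1)); last by lin.
transitivity (\sw_(r, s <- R) e r *: F s 1); last first.
  by rewrite (counitR_l (F := fun s => F s 1)) //; lin.
apply: eq_sw => r s.
rewrite -[in RHS](mulr1 s) -[in RHS](counitR_r (F := fun p => e r *: F (s * p) 1)); last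
    by lin.
by apply: eq_sw => p q; rewrite rmorphM scalerA mulrC.
Qed.

Lemma sw_comulR (X : lmodType k) x (F : H -> H -> X) : bil F ->
  sw (comulR R x) F =
  \sw_(a, b <- D x) \sw_(p, q <- R) \sw_(r, s <- R) F (a * q * S s) (r * b * p).
Proof.
move=> bF; rewrite /comulR sw_sum //; apply: eq_bigr => p _.
rewrite sw_sum //; transitivity (\sw_(r, s <- R) \sw_(r1, r2 <- D r) F (p.1 * S s) (r1 *
    p.2 * S r2)).
  apply: eq_bigr => r _; rewrite sw_tens // /adj (lin_bigsum (g := fun t => F _ t)) //; lin.
rewrite (hexagon_l (F := fun a b s => F (p.1 * S s) (a * p.2 * S b))); last by lin.
rewrite sw_exchange.
rewrite -(R_antipode (F := fun p0 q => \sw_(r, s <- R) F (p.1 * q * S s) (r * p.2 *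
    p0))); last by lin.
by do 2! (apply: eq_sw => ? ?); rewrite antipodeM mulrA.
Qed.

(** coadj h y = S(h) ·_ad y. *)
Definition coadj (h y : H) : H := \sw_(a, b <- D h) S b * y * S (S a).

(** The two coproducts in S(s) ·_ad y2 ⊗ S(r) ·_ad y1 split R into four copies by
    the hexagon identities; R_antipode then removes the antipodes in pairs. *)
Lemma coadj_R (X : lmodType k) y1 y2 (F : H -> H -> X) : bil F ->
  \sw_(r, s <- R) F (coadj s y2) (coadj r y1) =
  \sw_(p, q <- R) \sw_(r', s' <- R) \sw_(p', q' <- R) \sw_(r, s <- R)
    F (s' * s * y2 * q * S q') (p' * r' * y1 * S r * p).
Proof.
move=> bF.
transitivity (\sw_(r, s <- R) \sw_(r1, r2 <- D r) \sw_(s1, s2 <- D s)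
   F (S s2 * y2 * S (S s1)) (S r2 * y1 * S (S r1))).
  apply: eq_sw => r s; rewrite sw_exchange /coadj.
  rewrite (lin_of_sw (g := fun t => F t _)); last by lin.
  apply: eq_sw => s1 s2; rewrite (lin_of_sw (g := fun t => F _ t)) //; lin.
rewrite (hexagon_l (F := fun r1 r2 s => \sw_(s1, s2 <- D s) F (S s2 * y2 * S (S s1)) (S
    r2 * y1 * S (S r1)))); last by lin.
transitivity (\sw_(r, s <- R) \sw_(s1, s2 <- D s) \sw_(r', s' <- R) \sw_(s1', s2' <- D s')
   F (S s2' * S s2 * y2 * S (S s1) * S (S s1')) (S r' * y1 * S (S r))).
  apply: eq_sw => r s; rewrite sw_exchange; apply: eq_sw => r' s'.
  rewrite sw_comulM; last by lin.
  apply: eq_sw => s1 s2; apply: eq_sw => s1' s2'.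
  by rewrite !antipodeM !mulrA.
rewrite (hexagon_r (F := fun r s1 s2 => \sw_(r', s' <- R) \sw_(s1', s2' <- D s')
   F (S s2' * S s2 * y2 * S (S s1) * S (S s1')) (S r' * y1 * S (S r)))); last by lin.
transitivity (\sw_(r, s <- R) \sw_(p, q <- R) \sw_(r', s' <- R) \sw_(p', q' <- R)
  F (S s' * S s * y2 * S (S q) * S (S q')) (S p' * S r' * y1 * S (S r) * S (S p))).
  do 2! (apply: eq_sw => ? ?).
  rewrite (hexagon_r (F := fun r' s1' s2' => F (S s2' * S _ * y2 * S (S _) * S (S s1'))
      (S r' * y1 * S (S _)))); last by lin.
  by do 2! (apply: eq_sw => ? ?); rewrite !antipodeM !mulrA.
rewrite (R_antipode (F := fun r s => \sw_(p, q <- R) \sw_(r', s' <- R) \sw_(p', q' <- R)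
  F (S s' * s * y2 * S (S q) * S (S q')) (S p' * S r' * y1 * S r * S (S p)))); last by lin.
swap_at 0%N.
rewrite (R_antipode (F := fun p q => \sw_(r, s <- R) \sw_(r', s' <- R) \sw_(p', q' <- R)
  F (S s' * s * y2 * S q * S (S q')) (S p' * S r' * y1 * S r * S p))); last by lin.
rewrite (R_antipode (F := fun p q => \sw_(r, s <- R) \sw_(r', s' <- R) \sw_(p', q' <- R)
  F (S s' * s * y2 * q * S (S q')) (S p' * S r' * y1 * S r * p))); last by lin.
apply: eq_sw => p q; swap_at 0%N.
rewrite (R_antipode (F := fun r' s' => \sw_(r, s <- R) \sw_(p', q' <- R)
  F (s' * s * y2 * q * S (S q')) (S p' * r' * y1 * S r * p))); last by lin.
apply: eq_sw => r' s'; swap_at 0%N.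
by rewrite (R_antipode (F := fun p' q' => \sw_(r, s <- R)
  F (s' * s * y2 * q * S q') (p' * r' * y1 * S r * p))); last by lin.
Qed.

(** Δ_R is invariant under the braiding y1 ⊗ y2 |-> R^2 · y2 ⊗ R^1 · y1.  By
    sw_comulR and coadj_R there are six copies of R.  Two of them form a first
    R21 R, which is central; intertwining with Δ(x) makes two others adjacent, and
    they form a second R21 R; the product of both is 1 by monodromy_antipode, and
    the two remaining copies are those of Δ_R(x). *)
Lemma comulR_braided (X : lmodType k) x (F : H -> H -> X) : bil F ->
  sw (comulR R x) (fun y1 y2 => \sw_(r, s <- R) F (coadj s y2) (coadj r y1)) =
  sw (comulR R x) F.
Proof.
move=> bF.
transitivity (sw (comulR R x) (fun y1 y2 =>
  \sw_(p, q <- R) \sw_(r', s' <- R) \sw_(p', q' <- R) \sw_(r, s <- R)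
    F (s' * s * y2 * q * S q') (p' * r' * y1 * S r * p))).
  by apply: eq_sw => y1 y2; apply: coadj_R.
rewrite [LHS]sw_comulR; last by lin.
rewrite sw_comulR //.
(* Next to each other, the copies (n, n') and (r, s) of R form R21 R. *)
swap_at 2%N; swap_at 3%N; swap_at 4%N; swap_at 5%N.
transitivity (\sw_(x1, x2 <- D x) \sw_(l, m <- R) \sw_(p, q <- R) \sw_(r', s' <- R)
    \sw_(p', q' <- R) \sw_(a, b <- z)
   F (a * (s' * x2 * l * q * S q')) (S b * (p' * r' * x1 * m * p))).
  apply: eq_sw => x1 x2; apply: eq_sw => l m; apply: eq_sw => p q.
  apply: eq_sw => r' s'; apply: eq_sw => p' q'.
  transitivity (\sw_(r, s <- R) \sw_(n, n' <- R)
     F (s' * (s * n) * x2 * l * q * S q') (p' * r' * x1 * m * S (r * n') * p)).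
    by do 2! (apply: eq_sw => ? ?); rewrite antipodeM !mulrA.
  rewrite (sw_monodromy (F := fun a b => F (s' * a * x2 * l * q * S q') (p' * r' * x1 * m
      * S b * p))); last by lin.
  apply: sw_central; [lin|lin|move=> a b Za Zb].
  by rewrite -[s' * a]Za -[_ * S b](center_antipode Zb) !mulrA.
(* Bring (r', s') next to the coproduct of x, in order to use R Δ = Δ^op R. *)
swap_at 0%N; swap_at 1%N; swap_at 2%N; swap_at 3%N; swap_at 4%N.
swap_at 0%N; swap_at 2%N; swap_at 1%N; swap_at 3%N; swap_at 2%N.
transitivity (\sw_(p, q <- R) \sw_(p', q' <- R) \sw_(a, b <- z) \sw_(l, m <- R)
  \sw_(r', s' <- R) \sw_(x1, x2 <- D x)
   F (a * (x1 * (s' * l) * q * S q')) (S b * (p' * x2 * (r' * m) * p))).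
  apply: eq_sw => p q; apply: eq_sw => p' q'; apply: eq_sw => a b; apply: eq_sw => l m.
  transitivity (\sw_(r', s' <- R) \sw_(x1, x2 <- D x)
     F (a * ((s' * x2) * l * q * S q')) (S b * (p' * (r' * x1) * m * p))).
    by do 2! (apply: eq_sw => ? ?); rewrite !mulrA.
  rewrite (R_intertwines x (F := fun y1 y2 => F (a * (y2 * l * q * S q')) (S b * (p' * y1
      * m * p)))); last by lin.
  by do 2! (apply: eq_sw => ? ?); rewrite !mulrA.
(* Now (r', s') and (l, m) form the second R21 R. *)
swap_at 4%N; swap_at 3%N; swap_at 2%N; swap_at 1%N; swap_at 0%N.
swap_at 4%N.
apply: eq_sw => x1 x2; apply: eq_sw => p q; apply: eq_sw => p' q'.
transitivity (\sw_(a, b <- z) \sw_(a', b' <- z)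
   F (a * a' * (x1 * q * S q')) (S b * b' * (p' * x2 * p))).
  apply: eq_sw => a b.
  rewrite (sw_monodromy (F := fun a' b' => F (a * (x1 * a' * q * S q')) (S b * (p' * x2 *
      b' * p)))); last by lin.
  apply: sw_central; [lin|lin|move=> a' b' Za Zb].
  by rewrite -[x1 * a']Za -[p' * x2 * b']Zb !mulrA.
rewrite (monodromy_antipode (F := fun a b => F (a * (x1 * q * S q')) (b * (p' * x2 *
    p)))); last by lin.
by rewrite !mul1r.
Qed.
End AlmostTriangular.
End QuasiTriangular.

(** * The braided coaction on a Yetter-Drinfeld module *)

Section YD.
Variables (k : fieldType) (H : hopfAlgType k) (R : (H ⊗ H)%type).
Hypothesis qt : quasi_triangular R.
Variable V : ydModType H.
Local Notation S := (antipode : H -> H).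
Local Notation D := (comul : H -> (H ⊗ H)%type).
Local Notation e := (counit : H -> k).
Local Notation δ := (coact : V -> (H ⊗ V)%type).

Lemma act_scale (h : H) a (v : V) : act h (a *: v) = a *: act h v.
Proof. by rewrite linearZr_LR. Qed.

Lemma adj_linear1 (U : lmodType k) (g : U -> H) (x : H) :
  linear g -> linear (fun t => adj (g t) x).
Proof. by move=> lg; rewrite /adj; change (linear (fun t => \sw_(a, b <- D (g t)) a * x *
    S b)); lin. Qed.
Lemma adj_linear2 (U : lmodType k) (g : U -> H) (x : H) :
  linear g -> linear (fun t => adj x (g t)).
Proof. by move=> lg; rewrite /adj; change (linear (fun t => \sw_(a, b <- D x) a * g t * S
    b)); lin. Qed.
Lemma coadj_linear1 (U : lmodType k) (g : U -> H) (x : H) :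
  linear g -> linear (fun t => coadj (g t) x).
Proof. by move=> lg; rewrite /coadj; lin. Qed.
Lemma coadj_linear2 (U : lmodType k) (g : U -> H) (x : H) :
  linear g -> linear (fun t => coadj x (g t)).
Proof. by move=> lg; rewrite /coadj; lin. Qed.

Ltac lin_adj := repeat first
  [ lin1 | apply: adj_linear1 | apply: adj_linear2 | apply: coadj_linear1 | apply:
      coadj_linear2 ].

Section Functional.
Variable X : lmodType k.

Lemma sw_coassoc_mod v (F : H -> H -> V -> X) : tril F ->
  \sw_(a, v0 <- δ v) \sw_(a', v1 <- δ v0) F a a' v1 =
  \sw_(a, v0 <- δ v) \sw_(a1, a2 <- D a) F a1 a2 v0.
Proof.
move=> tF; have b3 := sw3 tF.
have /(congr1 (fun t => sw t (fun u s => sw s (F u)))) := coactA v.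
rewrite !(sw_sum _ _ _ b3) => h; refine (etrans _ _); [refine (etrans _ _); [|exact: h]|].
  apply: eq_bigr => p _; rewrite (sw_sum _ _ _ b3); apply: eq_bigr => q _.
  by rewrite sw_tens // sw_tens //; lin.
apply: eq_bigr => p _; rewrite (sw_sum _ _ _ b3); apply: eq_bigr => q _.
by rewrite sw_tens // sw_tens //; lin.
Qed.

Lemma sw_act_coact h v (F : H -> V -> X) : bil F ->
  \sw_(a, b <- D h) \sw_(c, v0 <- δ v) F (a * c) (act b v0) =
  \sw_(a, b <- D h) \sw_(c, v0 <- δ (act a v)) F (c * b) v0.
Proof.
move=> bF; have /(congr1 (fun t => sw t F)) := act_coact h v.
rewrite !sw_sum // => e1; refine (etrans _ _); [refine (etrans _ _); [|exact: e1]|].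
  by apply: eq_bigr => p _; rewrite sw_sum //; apply: eq_bigr => q _; rewrite sw_tens.
by apply: eq_bigr => p _; rewrite sw_sum //; apply: eq_bigr => q _; rewrite sw_tens.
Qed.

(** The Yetter-Drinfeld condition solved for the coaction of h v. *)
Lemma coact_act h v (F : H -> V -> X) : bil F ->
  sw (δ (act h v)) F =
  \sw_(h1, w <- D h) \sw_(h2, h3 <- D w) \sw_(a, v0 <- δ v)
    F (h1 * a * S h3) (act h2 v0).
Proof.
move=> bF.
rewrite (coassoc h (F := fun h1 h2 h3 => \sw_(a, v0 <- δ v) F (h1 * a * S h3) (act h2
    v0))); last by lin.
transitivity (\sw_(a, h3 <- D h) \sw_(h1, h2 <- D a) \sw_(c, v0 <- δ (act h1 v)) F (c *
    h2 * S h3) v0).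
  rewrite -(coassoc h (F := fun h1 h2 h3 => \sw_(c, v0 <- δ (act h1 v)) F (c * h2 * S h3)
      v0)); last by lin.
  transitivity (\sw_(h1, w <- D h) e w *: sw (δ (act h1 v)) F).
    by rewrite (counit_r h (F := fun h1 => sw (δ (act h1 v)) F)) //; lin.
  apply: eq_sw => h1 w; rewrite sw_exchange (lin_of_sw (g := fun t => e w *: t)); last by
      lin.
  apply: eq_sw => c v0.
  transitivity (\sw_(h2, h3 <- D w) F (c * (h2 * S h3)) v0).
    by rewrite (antipode_r w (F := fun t => F (c * t) v0)) ?mulr1 //; lin.
  by apply: eq_sw => ? ?; rewrite mulrA.
apply: eq_sw => a h3.
by rewrite -(sw_act_coact a v (F := fun c v0 => F (c * S h3) v0)) //; lin.
Qed.

Lemma sw_coactR v (F : H -> V -> X) : bil F ->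
  sw (coactR R v) F = \sw_(a, v0 <- δ v) \sw_(r, s <- R) F (a * S s) (act r v0).
Proof.
move=> bF; rewrite /coactR sw_sum //; apply: eq_bigr => p _.
by rewrite sw_sum //; apply: eq_bigr => q _; rewrite sw_tens.
Qed.

(** ρ_R is H-linear; R_intertwines moves h_(2), h_(3) across R. *)
Lemma coactR_act h v (F : H -> V -> X) : bil F ->
  sw (coactR R (act h v)) F =
  \sw_(a, b <- D h) \sw_(t, v0 <- coactR R v) F (adj a t) (act b v0).
Proof.
move=> bF; rewrite sw_coactR // (coact_act h v (F := fun a v0 => \sw_(r, s <- R) F (a * S
    s) (act r v0))); last by lin.
transitivity (\sw_(h1, w <- D h) \sw_(h2, h3 <- D w) \sw_(a, v0 <- δ v) \sw_(r, s <- R)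
   F (h1 * (a * S s) * S h2) (act h3 (act r v0))).
  apply: eq_sw => h1 w; rewrite sw_exchange [RHS]sw_exchange.
  apply: eq_sw => a v0; rewrite sw_exchange [RHS]sw_exchange.
  transitivity (\sw_(r, s <- R) \sw_(h2, h3 <- D w) F (h1 * a * S (s * h3)) (act (r * h2)
      v0)).
    by do 2! (apply: eq_sw => ? ?); rewrite antipodeM actM !mulrA.
  rewrite (R_intertwines qt w (F := fun x y => F (h1 * a * S y) (act x v0))); last by lin.
  by do 2! (apply: eq_sw => ? ?); rewrite antipodeM actM !mulrA.
rewrite (coassoc h (F := fun h1 h2 h3 => \sw_(a, v0 <- δ v) \sw_(r, s <- R)
   F (h1 * (a * S s) * S h2) (act h3 (act r v0)))); last by lin.
apply: eq_sw => a b; rewrite sw_coactR; last by lin_adj.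
rewrite sw_exchange; apply: eq_sw => c v0; rewrite sw_exchange; apply: eq_sw => r s.
by rewrite /adj (lin_bigsum (g := fun t => F t _)) //; lin.
Qed.

Lemma sw_comulR_def x (F : H -> H -> X) : bil F ->
  sw (comulR R x) F = \sw_(a, b <- D x) \sw_(r, s <- R) F (a * S s) (adj r b).
Proof.
move=> bF; rewrite /comulR sw_sum //; apply: eq_bigr => p _.
by rewrite sw_sum //; apply: eq_bigr => r _; rewrite sw_tens.
Qed.

End Functional.

Lemma coactR_linear : linear (@coactR k H V R).
Proof.
change (linear (fun v : V => \sw_(a, v0 <- δ v) \sw_(r, s <- R) (a * S s) ⊗ act r v0)).
by lin.
Qed.
Lemma lin_coactR (U : lmodType k) (g : U -> V) : linear g -> linear (fun x => @coactR k H
    V R (g x)).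
Proof. exact: (lin_comp2 coactR_linear). Qed.

Lemma comulR_linear : linear (comulR R).
Proof.
change (linear (fun x => \sw_(a, b <- D x) \sw_(r, s <- R) (a * S s) ⊗ adj r b)).
by lin_adj.
Qed.
Lemma lin_comulR (U : lmodType k) (g : U -> H) : linear g -> linear (fun x => comulR R (g
    x)).
Proof. exact: (lin_comp2 comulR_linear). Qed.

Ltac lin_coact := repeat first
  [ lin1 | apply: adj_linear1 | apply: adj_linear2 | apply: coadj_linear1 | apply:
      coadj_linear2
  | apply: lin_coactR | apply: lin_comulR ].

(** V is a comodule over (H, Δ_R): after the hexagon identities both sides become
    v_<-2> S(R'^2) S(R^2) ⊗ R^1 · (v_<-1> S(R''^2)) ⊗ R'^1 R''^1 v_<0>. *)
Lemma coactR_coassoc (X : lmodType k) v (F : H -> H -> V -> X) : tril F ->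
  \sw_(t, v0 <- coactR R v) \sw_(t1, t2 <- comulR R t) F t1 t2 v0 =
  \sw_(t, v0 <- coactR R v) \sw_(t', v1 <- coactR R v0) F t t' v1.
Proof.
move=> tF.
transitivity (\sw_(a, v0 <- δ v) \sw_(a1, a2 <- D a) \sw_(r, s <- R) \sw_(r0, s0 <- R)
    \sw_(r', s' <- R)
   F (a1 * S s0 * S s) (adj r (a2 * S s')) (act (r0 * r') v0)).
  rewrite sw_coactR; last by lin_coact.
  apply: eq_sw => a v0.
  transitivity (\sw_(a1, a2 <- D a) \sw_(r, s <- R) \sw_(q, q' <- R) \sw_(c, d <- D q')
     F (a1 * S d * S s) (adj r (a2 * S c)) (act q v0)).
    transitivity (\sw_(q, q' <- R) \sw_(a1, a2 <- D a) \sw_(r, s <- R) \sw_(c, d <- D q')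
     F (a1 * S d * S s) (adj r (a2 * S c)) (act q v0)); last by swap_at 0%N; swap_at 1%N.
    apply: eq_sw => q q'; rewrite sw_comulR_def; last by lin_coact.
    rewrite sw_comulM; last by lin_coact.
    apply: eq_sw => a1 a2.
    rewrite (comul_antipode q' (F := fun c d => \sw_(r, s <- R) F (a1 * c * S s) (adj r
        (a2 * d)) (act q v0))); last by lin_coact.
    by rewrite sw_exchange.
  apply: eq_sw => a1 a2; apply: eq_sw => r s.
  by rewrite (hexagon_r qt (F := fun q c d => F (a1 * S d * S s) (adj r (a2 * S c)) (act
      q v0))); last by lin_coact.
rewrite sw_coactR; last by lin_coact.
transitivity (\sw_(a, v0 <- δ v) \sw_(a', v1 <- δ v0) \sw_(r, s <- R) \sw_(r0, s0 <- R)
    \sw_(r', s' <- R)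
   F (a * S s0 * S s) (adj r (a' * S s')) (act (r0 * r') v1)).
  by rewrite -(sw_coassoc_mod v (F := fun a a' v1 => \sw_(r, s <- R) \sw_(r0, s0 <- R)
      \sw_(r', s' <- R)
   F (a * S s0 * S s) (adj r (a' * S s')) (act (r0 * r') v1))); last by lin_coact.
apply: eq_sw => a v0.
transitivity (\sw_(r, s <- R) \sw_(r1, r2 <- D r) \sw_(t', v1 <- coactR R v0) F (a * S s)
    (adj r1 t') (act r2 v1)).
  rewrite (hexagon_l qt (F := fun r1 r2 s => \sw_(t', v1 <- coactR R v0) F (a * S s) (adj
      r1 t') (act r2 v1))); last by lin_coact.
  rewrite sw_exchange; apply: eq_sw => r s; rewrite sw_exchange; apply: eq_sw => r0 s0.
  rewrite sw_coactR; last by lin_coact.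
  by do 2! (apply: eq_sw => ? ?); rewrite antipodeM actM !mulrA.
by apply: eq_sw => r s; rewrite coactR_act //; lin_coact.
Qed.

Lemma coactR_counit (v : V) : \sw_(t, v0 <- coactR R v) e t *: v0 = v.
Proof.
rewrite sw_coactR; last by lin.
rewrite -[RHS](coact_counit v) -/(sw (δ v) (fun a v0 => e a *: v0)); apply: eq_sw => a v0.
transitivity (\sw_(r, s <- R) e s *: (e a *: act r v0)).
  by apply: eq_sw => r s; rewrite rmorphM /= counit_antipode scalerA mulrC.
by rewrite (counitR_r qt (F := fun r => e a *: act r v0)) ?act1 //; lin.
Qed.

(** Inverting the definition of ρ_R, since R^1 p^1 ⊗ S(p^2) R^2 = 1. *)
Lemma coact_of_coactR (X : lmodType k) v (F : H -> V -> X) : bil F ->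
  \sw_(t, v0 <- coactR R v) \sw_(r, s <- R) F (t * s) (act r v0) = sw (δ v) F.
Proof.
move=> bF; rewrite sw_coactR; last by lin.
apply: eq_sw => a v0; rewrite sw_exchange.
transitivity (\sw_(r, s <- R) \sw_(p, q <- R) F (a * (S q * s)) (act (r * p) v0)).
  by do 2! (apply: eq_sw => ? ?); rewrite actM !mulrA.
by rewrite (antipodeR_rl qt (F := fun x y => F (a * y) (act x v0))) ?mulr1 ?act1 //; lin.
Qed.

(** The operators v |-> f(v_[-1]) v_[0]. *)
Definition coefop (f : H -> k) (v : V) : V := \sw_(t, v0 <- coactR R v) f t *: v0.

Lemma lin_fun_scale (U W : lmodType k) (f : H -> k) (g : U -> H) (w : W) :
  linear (f : H -> k^o) -> linear g -> linear (fun x => f (g x) *: w).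
Proof. by move=> lf lg; apply: lin_scalel; apply: (lin_comp2 lf lg). Qed.

(** The adjoint action of H on operators. *)
Definition adop (h : H) (phi : V -> V) (v : V) : V :=
  \sw_(a, b <- D h) act a (phi (act (S b) v)).

Ltac lin_functional := repeat first
  [ lin1 | apply: adj_linear1 | apply: adj_linear2 | apply: coadj_linear1 | apply:
      coadj_linear2
  | apply: lin_coactR | apply: lin_comulR
  | (apply: lin_fun_scale; [assumption|]) ].

Lemma coefop_linear (f : H -> k) : linear (f : H -> k^o) -> linear (coefop f).
Proof. by move=> lf; rewrite /coefop; lin_functional. Qed.

Lemma coefop_comp (f g : H -> k) v : linear (f : H -> k^o) -> linear (g : H -> k^o) ->
  coefop f (coefop g v) = coefop (fun x => \sw_(a, b <- comulR R x) (g a * f b : k^o)) v.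
Proof.
move=> lf lg.
rewrite {2}/coefop (lin_of_sw (g := coefop f)); last exact: coefop_linear.
transitivity (\sw_(t, v0 <- coactR R v) \sw_(t', v1 <- coactR R v0) g t *: (f t' *: v1)).
  apply: eq_sw => t v0; rewrite (linZ (g := coefop f)); last exact: coefop_linear.
  by rewrite /coefop (lin_of_sw (g := fun x : V => g t *: x)); last by lin.
rewrite -(coactR_coassoc v (F := fun t t' v1 => g t *: (f t' *: v1))); last by
    lin_functional.
apply: eq_sw => t v0.
rewrite (lin_of_sw (g := fun x : k^o => (x : k) *: v0)); last first.
  by move=> a x y; rewrite scalerDl scalerA.
by apply: eq_sw => a b; rewrite scalerA.
Qed.

Lemma coefop_counit v : coefop e v = v.
Proof. exact: coactR_counit. Qed.

Lemma coadjK h (y : H) : \sw_(a, b <- D h) coadj a (adj b y) = e h *: y.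
Proof.
transitivity (\sw_(a, b <- D h) \sw_(a1, a2 <- D a) \sw_(b1, b2 <- D b)
   S a2 * b1 * y * S (S a1 * b2)).
  apply: eq_sw => a b; apply: eq_sw => a1 a2.
  rewrite /adj -/(sw (D b) (fun a b => a * y * S b)).
  rewrite (lin_of_sw (g := fun t => S a2 * t * S (S a1))); last by lin.
  by apply: eq_sw => b1 b2; rewrite !antipodeM !mulrA.
rewrite -(coassoc h (F := fun a1 a2 b => \sw_(b1, b2 <- D b)
   S a2 * b1 * y * S (S a1 * b2))); last by lin.
transitivity (\sw_(a, w <- D h) y * S (S a * w)); last first.
  rewrite (antipode_l h (F := fun t => y * S t)); last by lin.
  by rewrite antipode1 mulr1.
apply: eq_sw => a w.
rewrite (coassoc w (F := fun a2 b1 b2 => S a2 * b1 * y * S (S a * b2))); last by lin.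
transitivity (\sw_(x, b2 <- D w) e x *: (y * S (S a * b2))); last first.
  by rewrite (counit_l w (F := fun b2 => y * S (S a * b2))) //; lin.
apply: eq_sw => x b2.
by rewrite (antipode_l x (F := fun t => t * y * S (S a * b2))) ?mul1r //; lin.
Qed.

Lemma lin_coadj_fun (f : H -> k) h : linear (f : H -> k^o) ->
  linear ((fun x => f (coadj h x)) : H -> k^o).
Proof. by move=> lf; apply: (lin_comp2 lf); lin_functional. Qed.

(** H-linearity of ρ_R read on the coefficient operators. *)
Lemma act_coefop h (f : H -> k) v : linear (f : H -> k^o) ->
  act h (coefop f v) = \sw_(a, b <- D h) coefop (fun x => f (coadj a x)) (act b v).
Proof.
move=> lf.
transitivity (\sw_(a, b <- D h) \sw_(b1, b2 <- D b) \sw_(t, v0 <- coactR R v)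
   f (coadj a (adj b1 t)) *: act b2 v0); last first.
  apply: eq_sw => a b; have lf' := @lin_coadj_fun f a lf.
  by rewrite /coefop (coactR_act b v (F := fun t v0 => f (coadj a t) *: v0)) //;
      lin_functional.
rewrite (coassoc h (F := fun a b1 b2 => \sw_(t, v0 <- coactR R v)
   f (coadj a (adj b1 t)) *: act b2 v0)); last by lin_functional.
transitivity (\sw_(a, b <- D h) e a *: \sw_(t, v0 <- coactR R v) f t *: act b v0).
  rewrite (counit_l h (F := fun b => \sw_(t, v0 <- coactR R v) f t *: act b v0)); last by
      lin_functional.
  rewrite /coefop (lin_of_sw (g := act h)); last by lin.
  by apply: eq_sw => t v0; rewrite act_scale.
apply: eq_sw => a b; rewrite (lin_of_sw (g := fun x : V => e a *: x)); last by lin.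
rewrite [RHS]sw_exchange; apply: eq_sw => t v0.
rewrite -(lin_of_sw (g := fun x : H => f x *: act b v0)); last by lin_functional.
by rewrite coadjK (linZ _ _ lf) scalerA.
Qed.

(** Membership in the algebra E of the coefficient operators, the image of the
    dual of the transmuted group H_R. *)
Definition transmuted (phi : V -> V) : Prop :=
  exists2 f : H -> k, linear (f : H -> k^o) & phi = coefop f.

Lemma transmuted_linear phi : transmuted phi -> linear phi.
Proof. by case=> f lf ->; apply: coefop_linear. Qed.

Lemma bil_coefop_coadj (f : H -> k) : linear (f : H -> k^o) ->
  bil (fun a v => coefop (fun x => f (coadj a x)) v).
Proof.
move=> lf; split=> [v|a]; last exact/coefop_linear/lin_coadj_fun.
by rewrite /coefop; lin_functional.
Qed.

Lemma adop_coefop h (f : H -> k) v : linear (f : H -> k^o) ->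
  adop h (coefop f) v = coefop (fun x => f (coadj h x)) v.
Proof.
move=> lf; have bG := bil_coefop_coadj lf.
set G := (fun a v => coefop (fun x => f (coadj a x)) v) in bG *.
transitivity (\sw_(a, b <- D h) \sw_(a1, a2 <- D a) G a1 (act (a2 * S b) v)).
  apply: eq_sw => a b; rewrite act_coefop //.
  by apply: eq_sw => a1 a2; rewrite actM.
rewrite -(coassoc h (F := fun a1 a2 b => G a1 (act (a2 * S b) v))); last by lin.
transitivity (\sw_(a, w <- D h) e w *: G a v).
  apply: eq_sw => a w.
  by rewrite (antipode_r w (F := fun t => G a (act t v))) ?act1 //; lin.
by rewrite (counit_r h (F := fun a => G a v)) //; lin.
Qed.

Lemma transmuted_adop h phi : transmuted phi -> transmuted (adop h phi).
Proof.
case=> f lf ->; exists (fun x => f (coadj h x)); first exact: lin_coadj_fun.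
by apply/funext => v; apply: adop_coefop.
Qed.

Lemma adop_bil phi : linear phi -> bil (fun h v => adop h phi v).
Proof. by move=> lp; rewrite /adop; lin. Qed.

Lemma act_adop h phi v : linear phi ->
  act h (phi v) = \sw_(a, b <- D h) adop a phi (act b v).
Proof.
move=> lp.
rewrite /adop -(coassoc h (F := fun a1 a2 b => act a1 (phi (act (S a2) (act b v)))));
    last by lin.
transitivity (\sw_(a, w <- D h) e w *: act a (phi v)).
  by rewrite (counit_r h (F := fun a => act a (phi v))) //; lin.
apply: eq_sw => a w.
transitivity (\sw_(x, y <- D w) act a (phi (act (S x * y) v))).
  by rewrite (antipode_l w (F := fun t => act a (phi (act t v)))) ?act1 //; lin.
by apply: eq_sw => x y; rewrite actM.
Qed.

Lemma adop_comp h phi psi v : linear phi -> linear psi ->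
  adop h (fun x => phi (psi x)) v = \sw_(a, b <- D h) adop a phi (adop b psi v).
Proof.
move=> lp ls.
transitivity (\sw_(a, b <- D h) \sw_(a1, a2 <- D a) \sw_(b1, b2 <- D b)
   act a1 (phi (act (S a2 * b1) (psi (act (S b2) v))))); last first.
  apply: eq_sw => a b; apply: eq_sw => a1 a2.
  rewrite /adop (lin_of_sw (g := fun x => act a1 (phi (act (S a2) x)))); last by lin.
  by apply: eq_sw => b1 b2; rewrite actM.
rewrite -(coassoc h (F := fun a1 a2 b => \sw_(b1, b2 <- D b)
   act a1 (phi (act (S a2 * b1) (psi (act (S b2) v)))))); last by lin.
apply: eq_sw => a w.
rewrite (coassoc w (F := fun a2 b1 b2 => act a (phi (act (S a2 * b1) (psi (act (S b2)
    v)))))); last by lin.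
transitivity (\sw_(x, b2 <- D w) e x *: act a (phi (psi (act (S b2) v)))).
  by rewrite (counit_l w (F := fun b2 => act a (phi (psi (act (S b2) v))))) //; lin.
apply: eq_sw => x b2.
by rewrite (antipode_l x (F := fun t => act a (phi (act t (psi (act (S b2) v)))))) ?act1
    //; lin.
Qed.

Lemma adopM g h phi v : linear phi -> adop (g * h) phi v = adop g (adop h phi) v.
Proof.
move=> lp; rewrite /adop sw_comulM; last by lin.
apply: eq_sw => a b; rewrite (lin_of_sw (g := act a)); last by lin.
by apply: eq_sw => c d; rewrite antipodeM !actM.
Qed.

Lemma adop_id h v : adop h id v = e h *: v.
Proof.
rewrite /adop -[in RHS](act1 v) -(antipode_r h (F := fun t => act t v)); last by lin.
by apply: eq_sw => a b; rewrite actM.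
Qed.

Section Braided.
Hypothesis central : tensor_of (@center k H) (@center k H) (tmul (flip R) R).

(** The product in E is dual to Δ_R, so this is comulR_braided. *)
Lemma braided_commutative phi psi v : transmuted phi -> transmuted psi ->
  phi (psi v) = \sw_(r, s <- R) adop s psi (adop r phi v).
Proof.
move=> [f lf ->] [g lg ->]; rewrite coefop_comp //.
transitivity (\sw_(r, s <- R) coefop (fun x => \sw_(a, b <- comulR R x)
    (f (coadj r a) * g (coadj s b) : k^o)) v); last first.
  apply: eq_sw => r s; rewrite -coefop_comp; [|exact: lin_coadj_fun..].
  have -> : adop s (coefop g) = coefop (fun x => g (coadj s x)).
    by apply/funext => w; apply: adop_coefop.
  by rewrite adop_coefop.
rewrite /coefop sw_exchange; apply: eq_sw => t v0.
rewrite -(lin_of_sw (g := fun x : k^o => (x : k) *: v0)); last first.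
  by move=> a x y; rewrite scalerDl scalerA.
congr (_ *: _).
have bF : bil (fun u w : H => (g u * f w : k^o)).
  split=> [w a x y|u a x y].
    by rewrite lg mulrDl -mulrA.
  by rewrite lf mulrDr mulrCA.
rewrite -(comulR_braided qt central t bF) [RHS]sw_exchange.
by apply: eq_bigr => p _; apply: eq_bigr => q _; rewrite mulrC.
Qed.

(** The left action of E turned into a right one by the braiding. *)
Definition ract (phi : V -> V) (v : V) : V := \sw_(r, s <- R) adop s phi (act r v).

(** Moving ψ past φ v with act_adop and the first hexagon identity leaves
    (R^2 · ψ') (R^1 · φ), which is φ ψ'. *)
Lemma ract_comm phi psi v : transmuted phi -> transmuted psi ->
  phi (ract psi v) = ract psi (phi v).
Proof.
move=> Ep Es; have lp := transmuted_linear Ep; have ls := transmuted_linear Es.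
have ba := @adop_bil _ lp; have bs := @adop_bil _ ls.
transitivity (\sw_(r, s <- R) \sw_(r1, r2 <- D r) adop s psi (adop r1 phi (act r2 v)));
    last first.
  apply: eq_sw => r s; rewrite (act_adop _ _ lp) (lin_of_sw (g := adop s psi)) //.
  exact: bs.2.
rewrite (hexagon_l qt (F := fun r1 r2 s => adop s psi (adop r1 phi (act r2 v)))); last by
    lin.
rewrite /ract (lin_of_sw (g := phi)) // sw_exchange.
apply: eq_sw => r' s'.
rewrite (braided_commutative _ Ep (transmuted_adop s' Es)).
by apply: eq_sw => r s; rewrite adopM.
Qed.

Lemma ract_comp phi psi v : transmuted phi -> transmuted psi ->
  ract (fun x => phi (psi x)) v = ract psi (ract phi v).
Proof.
move=> Ep Es; have lp := transmuted_linear Ep; have ls := transmuted_linear Es.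
have bp := @adop_bil _ lp; have bs := @adop_bil _ ls.
transitivity (\sw_(r, s <- R) \sw_(p, q <- R) adop q phi (adop s psi (act (r * p) v))).
  rewrite -(hexagon_r qt (F := fun r a b => adop a phi (adop b psi (act r v)))); last by
      lin.
  by apply: eq_sw => r s; rewrite adop_comp.
transitivity (\sw_(r, s <- R) \sw_(r', s' <- R) \sw_(r1, r2 <- D r)
   adop s psi (adop r1 (adop s' phi) (act r2 (act r' v)))); last first.
  apply: eq_sw => r s; rewrite /ract.
  rewrite (lin_of_sw (g := fun x => adop s psi (act r x))); last by lin.
  apply: eq_sw => r' s'; have la := bp.2 s'.
  by rewrite (act_adop _ _ la) (lin_of_sw (g := adop s psi)) //; apply: bs.2.
rewrite sw_exchange [RHS]sw_exchange; apply: eq_sw => r' s'.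
have la := bp.2 s'; have ba := @adop_bil _ la.
rewrite (hexagon_l qt (F := fun r1 r2 s =>
   adop s psi (adop r1 (adop s' phi) (act r2 (act r' v))))); last by lin.
rewrite [RHS]sw_exchange; apply: eq_sw => p q.
rewrite (braided_commutative _ (transmuted_adop s' Ep) (transmuted_adop q Es)).
by apply: eq_sw => r s; rewrite adopM // actM.
Qed.

Lemma ract_id v : ract id v = v.
Proof.
rewrite /ract; transitivity (\sw_(r, s <- R) e s *: act r v).
  by apply: eq_sw => r s; rewrite adop_id.
by rewrite (counitR_r qt (F := fun r => act r v)) ?act1 //; lin.
Qed.
End Braided.

Lemma transmuted_comp phi psi : transmuted phi -> transmuted psi ->
  transmuted (fun x => phi (psi x)).
Proof.
case=> f lf -> [g lg ->].
exists (fun x => \sw_(a, b <- comulR R x) (g a * f b : k^o)); last first.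
  by apply/funext => v; rewrite coefop_comp.
have bF : bil (fun u w : H => (g u * f w : k^o)).
  split=> [w a x y|u a x y].
    by rewrite lg mulrDl -mulrA.
  by rewrite lf mulrDr mulrCA.
by lin_coact.
Qed.

Lemma transmuted_id : transmuted id.
Proof.
exists e; first by move=> a x y; rewrite linearP.
by apply/funext => v; rewrite coefop_counit.
Qed.

Lemma transmuted_lin a phi psi : transmuted phi -> transmuted psi ->
  transmuted (fun x => a *: phi x + psi x).
Proof.
case=> f lf -> [g lg ->]; exists (fun x => a * f x + g x).
  move=> c x y; rewrite lf lg /= !scalerDr /GRing.scale /= !mulrDr.
  by rewrite addrACA (mulrCA a c).
apply/funext => v; rewrite /coefop (lin_of_sw (g := fun x : V => a *: x)); last by lin.
rewrite /sw -big_split; apply: eq_bigr => p _ /=.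
by rewrite scalerDl scalerA.
Qed.

Lemma transmuted0 : transmuted (fun=> 0).
Proof.
exists (fun=> 0); first by move=> c x y; rewrite scaler0 addr0.
by apply/funext => v; rewrite /coefop /sw big1 // => p _; rewrite scale0r.
Qed.
End YD.

Local Open Scope classical_set_scope.

(** * Linear algebra in arbitrary dimension *)

Section Separation.
Variables (k : fieldType) (U : lmodType k).

Lemma subspaceZ (A : set U) a x : subspace A -> A x -> A (a *: x).
Proof. by move=> [A0 AL] Ax; rewrite -[_ *: _]addr0; apply: AL. Qed.
Lemma subspaceD (A : set U) x y : subspace A -> A x -> A y -> A (x + y).
Proof. by move=> [A0 AL] Ax Ay; rewrite -[x]scale1r; apply: AL. Qed.
Lemma subspaceB (A : set U) x y : subspace A -> A x -> A y -> A (x - y).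
Proof. by move=> sA Ax Ay; rewrite addrC -scaleN1r; apply: sA.2. Qed.
Lemma subspace_sum (A : set U) I (r : seq I) (P : pred I) (F : I -> U) :
  subspace A -> (forall i, P i -> A (F i)) -> A (\sum_(i <- r | P i) F i).
Proof.
move=> sA AF; elim/big_ind: _ => //; first exact: sA.1.
by move=> x y; apply: subspaceD.
Qed.

(** By Zorn's lemma there is a maximal subspace M containing A but not x; the line
    through x is a complement of M, and f is the coordinate along it. *)
Lemma separation (A : set U) (x : U) : subspace A -> ~ A x ->
  exists f : U -> k, [/\ linear (f : U -> k^o), forall y, A y -> f y = 0 & f x = 1].
Proof.
move=> sA Ax.
pose P (B : set U) := B = set0 \/ [/\ subspace B, A `<=` B & ~ B x].
have chainP (F : set (set U)) : F `<=` P -> total_on F subset ->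
    P (\bigcup_(X in F) X).
  move=> FP Ft.
  have [[B [FB [b Bb]]]|none] := pselect (exists B, F B /\ exists b, B b); last first.
    left; apply/seteqP; split=> // y [B FB By]; case: none; exists B; split=> //.
    by exists y.
  have ne C c : F C -> C c -> [/\ subspace C, A `<=` C & ~ C x].
    by move=> FC Cc; case: (FP _ FC) => // C0; move: Cc; rewrite C0.
  have [sB AB Bx] := ne _ _ FB Bb; right; split.
  - split; first by exists B => //; apply: sB.1.
    move=> a y z [C FC Cy] [C' FC' C'z].
    have [sC _ _] := ne _ _ FC Cy; have [sC' _ _] := ne _ _ FC' C'z.
    have [le|le] := Ft _ _ FC FC'.
      by exists C' => //; apply: sC'.2 => //; apply: le.
    by exists C => //; apply: sC.2 => //; apply: le.
  - by move=> y Ay; exists B => //; apply: AB.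
  - by move=> [C FC Cx]; have [_ _] := ne _ _ FC Cx; apply.
have [M [PM maxM]] := Zorn_bigcup chainP.
have [sM AM Mx] : [/\ subspace M, A `<=` M & ~ M x].
  case: PM => // M0; case: (maxM A); last by right; split.
  by rewrite M0; split=> [y []|le]; exact: (le 0 sA.1).
have ex y : exists c, M (y - c *: x).
  have [My|My] := pselect (M y); first by exists 0; rewrite scale0r subr0.
  pose M' := [set t | exists w a, M w /\ t = w + a *: y].
  have MM' : M `<=` M' by move=> w Mw; exists w, 0; rewrite scale0r addr0.
  have sM' : subspace M'.
    split; first exact/MM'/sM.1.
    move=> a _ _ [w [b [Mw ->]]] [w' [b' [Mw' ->]]].
    exists (a *: w + w'), (a * b + b'); split; first exact: sM.2.
    by rewrite scalerDr scalerA scalerDl addrACA.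
  have M'y : M' y by exists 0, 1; rewrite scale1r add0r; split=> //; apply: sM.1.
  have M'x : M' x.
    apply: contrapT => nM'x; apply: (maxM M').
      by split=> // le; apply: My; apply: le.
    by right; split=> // t At; apply/MM'/AM.
  case: M'x => w [a [Mw xE]].
  have a0 : a != 0.
    by apply: contra_notN Mx => /eqP a0; rewrite xE a0 scale0r addr0.
  exists a^-1; rewrite {1}xE scalerDr scalerA mulVf // scale1r opprD addrCA subrr addr0.
  by rewrite -scalerN; apply: subspaceZ => //; rewrite -scaleN1r; apply: subspaceZ.
have [f fP] := choice ex.
have uniq y c : M (y - c *: x) -> f y = c.
  move=> Myc; apply/eqP; rewrite -subr_eq0; apply: contra_notT Mx => ne.
  have : M ((f y - c) *: x).
    have := subspaceB sM Myc (fP y).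
    by rewrite opprB addrC addrA subrK scalerBl.
  by move/(subspaceZ (f y - c)^-1 sM); rewrite scalerA mulVf // scale1r.
exists f; split.
- move=> a y z; apply: uniq.
  have -> : a *: y + z - (a *: (f y : k^o) + f z) *: x =
            a *: (y - f y *: x) + (z - f z *: x).
    by rewrite scalerBr scalerDl scalerA opprD addrACA.
  exact: sM.2.
- by move=> y /AM My; apply: uniq; rewrite scale0r subr0.
- by apply: uniq; rewrite scale1r subrr; apply: sM.1.
Qed.

Definition dual_families n (b : 'I_n -> U) (f : 'I_n -> U -> k) :=
  (forall i, linear (f i : U -> k^o)) /\ (forall i j, f i (b j) = (i == j)%:R).

(** Gram-Schmidt with functionals instead of a scalar product: a vector outside the
    span of the b_i is corrected by its components, and separated from 0. *)
Lemma dual_family (s : seq U) : exists n (b : 'I_n -> U) (f : 'I_n -> U -> k),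
  dual_families b f /\ forall x, x \in s -> x = \sum_i f i x *: b i.
Proof.
elim: s => [|x s [n [b [f [[lf fb] bs]]]]].
  by exists 0%N, (fun=> 0), (fun _ _ => 0); split=> //; split=> -[].
pose x' := x - \sum_i f i x *: b i.
have fx' i : f i x' = 0.
  rewrite /x' (linD (g := f i : U -> k^o)) // -scaleN1r (linZ (g := f i : U -> k^o)) //.
  rewrite (lin_bigsum (g := f i : U -> k^o)) // (bigD1 i) //= big1.
    rewrite (linZ (g := f i : U -> k^o)) // fb eqxx addr0 /GRing.scale /=.
    by rewrite mulr1 mulN1r subrr.
  move=> j /negPf ji; rewrite (linZ (g := f i : U -> k^o)) // fb eq_sym ji.
  exact: mulr0.
have [x'0|x'0] := eqVneq x' 0.
  exists n, b, f; split=> // y; rewrite inE => /orP[/eqP ->|]; last exact: bs.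
  by apply/eqP; rewrite -subr_eq0 -/x' x'0.
have [] := @separation [set 0] x'.
- by split=> // a y z /= -> ->; rewrite scaler0 addr0.
- exact/eqP.
move=> g [lg _ gx'].
pose g' y := g y - \sum_i g (b i) * f i y.
have lg' : linear (g' : U -> k^o).
  move=> a y z; rewrite /g' lg scalerBr addrACA -opprD; congr (_ - _).
  rewrite scaler_sumr -big_split; apply: eq_bigr => i _ /=.
  by rewrite lf mulrDr; congr (_ + _); apply: mulrCA.
have g'b j : g' (b j) = 0.
  rewrite /g' (bigD1 j) //= fb eqxx mulr1 big1 ?addr0 ?subrr // => i /negPf ij.
  by rewrite fb ij mulr0.
have g'x : g' x' = 1.
  by rewrite /g' gx' big1 ?subr0 // => i _; rewrite fx' mulr0.
pose b' (i : 'I_n.+1) := oapp b x' (unlift ord0 i).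
pose f' (i : 'I_n.+1) := oapp f g' (unlift ord0 i).
exists n.+1, b', f'; split; first split.
- by move=> i; rewrite /f'; case: unliftP => [j _|_] /=; [exact: lf|exact: lg'].
- move=> i j; rewrite /f' /b'.
  case: unliftP => [i' ->|->]; case: unliftP => [j' ->|->] /=.
  + by rewrite fb (inj_eq lift_inj).
  + by rewrite fx'.
  + by rewrite g'b.
  + exact: g'x.
have f's y : \sum_i f' i y *: b' i = g' y *: x' + \sum_i f i y *: b i.
  rewrite big_ord_recl /f' /b' unlift_none /=; congr (_ + _).
  by apply: eq_bigr => i _; rewrite liftK.
move=> y; rewrite inE f's => /orP[/eqP ->|/bs ys].
  have -> : g' x = 1.
    rewrite -g'x /x' (linD (g := g' : U -> k^o)) // -scaleN1r (linZ (g := g' : U -> k^o))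
        //.
    rewrite (lin_bigsum (g := g' : U -> k^o)) // big1 ?scaler0 ?addr0 // => i _.
    by rewrite (linZ (g := g' : U -> k^o)) // g'b scaler0.
  by rewrite scale1r subrK.
rewrite {1}ys; have -> : g' y = 0; last by rewrite scale0r add0r.
rewrite ys (lin_bigsum (g := g' : U -> k^o)) // big1 // => i _.
by rewrite (linZ (g := g' : U -> k^o)) // g'b scaler0.
Qed.

Definition basis n (b : 'I_n -> U) (f : 'I_n -> U -> k) :=
  dual_families b f /\ forall x, x = \sum_i f i x *: b i.

Definition findim := exists n (b : 'I_n -> U) (f : 'I_n -> U -> k), basis b f.

Lemma findim_span (I : finType) (c : I -> U) :
  (forall x, exists a : I -> k, x = \sum_i a i *: c i) -> findim.
Proof.
move=> span; have [n [b [f [bf bs]]]] := dual_family [seq c i | i <- enum I].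
exists n, b, f; split=> // x; have [a ->] := span x.
have cE i : c i = \sum_j f j (c i) *: b j.
  by apply: bs; apply/mapP; exists i; rewrite ?mem_enum.
transitivity (\sum_i \sum_j a i *: (f j (c i) *: b j)).
  by apply: eq_bigr => i _; rewrite {1}cE scaler_sumr.
rewrite exchange_big /=; apply: eq_bigr => j _.
rewrite (lin_bigsum (g := f j : U -> k^o)); last by case: bf.
rewrite scaler_suml; apply: eq_bigr => i _.
by rewrite (linZ (g := f j : U -> k^o)) ?scalerA //; case: bf.
Qed.

Lemma findim_embed (W : vectType k) (g : U -> W) :
  linear g -> (forall x, g x = 0 -> x = 0) -> findim.
Proof.
move=> lg inj.
have [T TP] : {T : {vspace W} | forall y, y \in T <-> exists x, g x = y}.
  apply: vspace_comprehension; first by exists 0; apply: lin0.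
  by move=> a _ _ [x <-] [y <-]; exists (a *: x + y); rewrite lg.
have /choice[c cP] : forall i : 'I_(\dim T), exists x, g x = (vbasis T)`_i.
  by move=> i; apply/TP; rewrite vbasis_mem // mem_nth // size_tuple.
apply: (findim_span (c := c)) => x.
have /coord_vbasis xE : g x \in T by apply/TP; exists x.
exists (fun i => coord (vbasis T) i (g x)); apply/eqP; rewrite -subr_eq0; apply/eqP/inj.
rewrite (linD (g := g)) // -scaleN1r (linZ (g := g)) // scaleN1r (lin_bigsum (g := g)) //
    {1}xE.
apply/eqP; rewrite subr_eq0; apply/eqP; apply: eq_bigr => i _.
by rewrite (linZ (g := g)) // cP.
Qed.
End Separation.

Section TensorOf.
Variables (k : fieldType) (U W : lmodType k) (A : set U) (B : set W).

Lemma tensor_of_pure u w : A u -> B w -> tensor_of A B (u ⊗ w).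
Proof.
by move=> Au Bw; exists [:: (u, w)]; rewrite ?big_seq1 // => p; rewrite inE => /eqP ->.
Qed.

Lemma tensor_of_sum I (r : seq I) (P : pred I) F :
  (forall i, P i -> tensor_of A B (F i)) -> tensor_of A B (\sum_(i <- r | P i) F i).
Proof.
move=> AF; elim/big_ind: _ => //; first by exists [::]; rewrite ?big_nil.
move=> _ _ [s sAB ->] [t tAB ->]; exists (s ++ t); rewrite ?big_cat // => p.
by rewrite mem_cat => /orP[/sAB|/tAB].
Qed.

Lemma tensor_of_sw (U' W' : lmodType k) (t : (U' ⊗ W')%type) F :
  (forall a b, tensor_of A B (F a b)) -> tensor_of A B (sw t F).
Proof. by move=> AF; apply: tensor_of_sum => p _. Qed.
End TensorOf.

(** t = Σ_i b_i ⊗ (f_i ⊗ id)(t), with independent b_i. *)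
Lemma tensor_expand (k : fieldType) (U W : lmodType k) (t : (U ⊗ W)%type) :
  exists n (b : 'I_n -> U) (f : 'I_n -> U -> k), dual_families b f /\
  forall (X : lmodType k) (F : U -> W -> X), bil F ->
    sw t F = \sum_i F (b i) (\sw_(p, q <- t) f i p *: q).
Proof.
have [n [b [f [bf bs]]]] := dual_family [seq p.1 | p <- terms t].
exists n, b, f; split=> // X F bF.
transitivity (\sum_(p <- terms t) \sum_i F (b i) (f i p.1 *: p.2)).
  rewrite /sw !big_seq; apply: eq_bigr => p pt.
  rewrite {1}(bs p.1); last exact: map_f.
  rewrite (lin_bigsum (g := fun u => F u p.2)); last exact: bF.1.
  apply: eq_bigr => i _; rewrite (linZ (g := fun u => F u p.2)); last exact: bF.1.
  by rewrite (linZ (g := F (b i))) //; apply: bF.2.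
rewrite exchange_big /=; apply: eq_bigr => i _.
by rewrite /sw (lin_bigsum (g := F (b i))) //; apply: bF.2.
Qed.

(** * Finite-dimensionality *)

Section FiniteDimension.
Variables (k : fieldType) (H : hopfAlgType k).
Local Notation S := (antipode : H -> H).
Local Notation D := (comul : H -> (H ⊗ H)%type).
Local Notation e := (counit : H -> k).

(** The component of 1 in a left ideal complementary to the kernel of ε. *)
Lemma integral_exists : semisimple_alg H ->
  exists2 L : H, e L = 1 & forall h, h * L = e h *: L.
Proof.
move=> ss; pose I := [set h : H | e h = 0].
have sI : left_ideal I.
  split; first split; rewrite /I /=; first exact: raddf0.
    move=> a x y /= x0 y0; have -> : e (a *: x + y) = a * e x + e y by exact: linearP.
    by rewrite x0 y0 mulr0 addr0.
  by move=> h x /= x0; transitivity (e h * e x); [exact: rmorphM|rewrite x0 mulr0].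
have [J [[sJ mJ] IJ /(_ 1)[x [L [Ix JL xL]]]]] := ss I sI.
have eL : e L = 1.
  have e1 : e 1 = 1 by exact: rmorph1.
  have eD : e (x + L) = e x + e L by exact: raddfD.
  by rewrite -e1 xL eD (Ix : e x = 0) add0r.
exists L => // h; apply/eqP; rewrite -subr_eq0; apply/eqP.
have : (I `&` J) (h * L - e h *: L); last by rewrite IJ.
split; last by apply: subspaceB; [|apply: mJ|apply: subspaceZ].
have eP : e (h * L - e h *: L) = e (h * L) - e h * e L.
  by rewrite raddfB /=; congr (_ - _); apply: linearZ.
by rewrite /I /= eP rmorphM /= eL mulr1 subrr.
Qed.

(** From an integral L one gets S(h) L_(1) ⊗ L_(2) = L_(1) ⊗ h L_(2).  Expand
    Δ(L) = Σ_i b_i ⊗ y_i with functionals f_i dual to the b_i.  If the matrix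
    f_i(S(h) b_j) vanishes then h y_i = 0 for all i, so
    S(h) = S(h) L_(1) S(L_(2)) = L_(1) S(h L_(2)) = 0 and h = 0.  So H embeds in a
    space of matrices. *)
Lemma hopf_findim (R : (H ⊗ H)%type) : quasi_triangular R -> semisimple_alg H ->
  findim H.
Proof.
move=> qt /integral_exists[L eL hL].
have [n [b [f [[lf fb] expand]]]] := tensor_expand (D L).
set y := fun i => \sw_(p, q <- D L) f i p *: q in expand.
have key (X : lmodType k) h (F : H -> H -> X) : bil F ->
    \sw_(a, c <- D L) F (S h * a) c = \sw_(a, c <- D L) F a (h * c).
  move=> bF.
  transitivity (\sw_(h1, h2 <- D h) sw (D (h2 * L)) (fun a c => F (S h1 * a) c)).
    transitivity (\sw_(h1, h2 <- D h) e h2 *: \sw_(a, c <- D L) F (S h1 * a) c).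
      by rewrite (counit_r h (F := fun h1 => \sw_(a, c <- D L) F (S h1 * a) c)) //; lin.
    apply: eq_sw => h1 h2; rewrite hL linearZ /= (linZ (g := fun t => sw t _)) //.
    by apply: sw_linear; lin.
  transitivity (\sw_(h1, h2 <- D h) \sw_(g1, g2 <- D h2) \sw_(a, c <- D L)
     F (S h1 * g1 * a) (g2 * c)).
    apply: eq_sw => h1 h2; rewrite sw_comulM; last by lin.
    by do 2! (apply: eq_sw => ? ?); rewrite mulrA.
  rewrite (coassoc h (F := fun h1 g1 g2 => \sw_(a, c <- D L) F (S h1 * g1 * a) (g2 *
      c))); last by lin.
  transitivity (\sw_(w, g <- D h) e w *: \sw_(a, c <- D L) F a (g * c)); last first.
    by rewrite (counit_l h (F := fun g => \sw_(a, c <- D L) F a (g * c))) //; lin.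
  apply: eq_sw => w g.
  rewrite (antipode_l w (F := fun t => \sw_(a, c <- D L) F (t * a) (g * c))); last by lin.
  by congr (_ *: _); apply: eq_sw => a c; rewrite mul1r.
pose m h := \matrix_(i < n, j < n) f i (S h * b j).
apply: (findim_embed (g := m)).
  move=> a h h'; apply/matrixP => i j; rewrite !mxE.
  by rewrite linearP mulrDl -scalerAl lf.
move=> h mh.
have hy i : h * y i = 0.
  rewrite /y (lin_of_sw (g := fun t => h * t)); last by lin.
  transitivity (\sw_(a, c <- D L) f i a *: (h * c)).
    by apply: eq_sw => a c; rewrite scalerAr.
  have bl : bil (fun a c : H => f i a *: c).
    by split=> [w|u]; [apply: lin_scalel; apply: lf|lin].
  rewrite -(key _ h _ bl) (expand _ (fun a c => f i (S h * a) *: c)); last first.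
    split=> [w|u]; last by lin.
    by apply: lin_scalel; apply: (lin_comp2 (lf i)); lin.
  rewrite big1 // => j _.
  by have /matrixP/(_ i j) := mh; rewrite !mxE => ->; rewrite scale0r.
have Sh0 : S h = 0.
  transitivity (\sw_(a, c <- D L) S h * a * S c).
    have e1 : \sw_(a, c <- D L) S h * (a * S c) = S h.
      by rewrite (antipode_r L (F := fun t => S h * t)) ?eL ?scale1r ?mulr1 //; lin.
    by rewrite -[LHS]e1; apply: eq_sw => a c; rewrite mulrA.
  rewrite (key _ h (fun a c => a * S c)); last by lin.
  rewrite (expand _ (fun a c => a * S (h * c))); last by lin.
  by rewrite big1 // => i _; rewrite -/(y i) hy linear0 mulr0.
by apply: (antipode_inj qt); rewrite Sh0 linear0.
Qed.

(** The coefficients w_i of the coaction of a nonzero v span a subcomodule, hence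
    the H-submodule they generate is a Yetter-Drinfeld submodule. *)
Lemma yd_findim (V : ydModType H) : findim H -> yd_irreducible V -> findim V.
Proof.
move=> [d [hb [hf [_ hE]]]] [[v vn0] irr].
have [n [u [f [[lf fu] expand]]]] := tensor_expand (coact v).
set w := fun i => \sw_(p, q <- coact v) f i p *: q in expand.
pose W : set V := [set x | exists a : 'I_n -> H, x = \sum_i act (a i) (w i)].
have sW : subspace W.
  split; first by exists (fun=> 0); rewrite big1 // => i _; rewrite linear0l.
  move=> c _ _ [a ->] [a' ->]; exists (fun i => c *: a i + a' i).
  by rewrite scaler_sumr -big_split; apply: eq_bigr => i _; rewrite linearPl.
have Wact h i : W (act h (w i)).
  exists (fun j => if j == i then h else 0); rewrite (bigD1 i) //= eqxx big1 ?addr0 // => j.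
  by move=> /negPf ->; rewrite linear0l.
have coactw (X : lmodType k) j (F : H -> V -> X) : bil F ->
    sw (coact (w j)) F = \sum_i \sw_(a1, a2 <- D (u i)) f j a1 *: F a2 (w i).
  move=> bF; rewrite {1}/w (lin_of_sw (g := fun x => sw (coact x) F)); last by lin.
  have tF : tril (fun (a a' : H) (v1 : V) => f j a *: F a' v1).
    split=> [p q|p q|p q]; [by apply: lin_scalel; apply: lf|by lin|by lin].
  transitivity (\sw_(a, v0 <- coact v) \sw_(a', v1 <- coact v0) f j a *: F a' v1).
    apply: eq_sw => a v0; rewrite linearZ /= (linZ (g := fun t => sw t F)); last exact:
        sw_linear.
    by rewrite (lin_of_sw (g := fun x : X => f j a *: x)) //; lin.
  rewrite (sw_coassoc_mod v tF).
  by rewrite (expand _ (fun a v0 => \sw_(a1, a2 <- D a) f j a1 *: F a2 v0)) //; lin.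
have WT : W = [set: V].
  case: (irr W) => //; last first.
    move=> W0; exfalso; move/eqP: vn0; apply.
    have : W v; last by rewrite W0.
    rewrite -(coact_counit v) -/(sw (coact v) (fun a v0 => e a *: v0)).
    rewrite (expand _ (fun a v0 => e a *: v0)); last by lin.
    apply: subspace_sum => // i _; apply: subspaceZ => //.
    by have := Wact 1 i; rewrite act1.
  split=> //.
    move=> h _ [a ->]; rewrite linear_sumr; apply: subspace_sum => // i _.
    by rewrite -actM.
  move=> _ [a ->]; rewrite linear_sum; apply: tensor_of_sum => i _.
  rewrite -[coact _]sw_id coact_act; last by lin.
  apply: tensor_of_sw => h1 h'; apply: tensor_of_sw => h2 h3.
  rewrite coactw; last by lin.
  apply: tensor_of_sum => j _; apply: tensor_of_sw => a1 a2.
  by rewrite -linearZl_LR; apply: tensor_of_pure.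
apply: (findim_span (I := ('I_d * 'I_n)%type) (c := fun p => act (hb p.1) (w p.2))).
move=> x; have [a ->] : W x by rewrite WT.
exists (fun p => hf p.1 (a p.2)).
rewrite -(pair_bigA _ (fun i j => hf i (a j) *: act (hb i) (w j))) exchange_big /=.
apply: eq_bigr => j _; rewrite {1}(hE (a j)).
rewrite (lin_bigsum (g := fun h => act h (w j))); last by lin.
apply: eq_bigr => i _.
by rewrite linearZl_LR.
Qed.
End FiniteDimension.

(** * The algebra of coefficient operators *)

Section VectOfBasis.
Variables (k : fieldType) (U : lmodType k) (n : nat) (b : 'I_n -> U) (f : 'I_n -> U -> k).
Hypothesis bf : basis b f.

Fact basis_axiom : Vector.axiom n U.
Proof.
case: bf => -[lf fb] bE; exists (fun x => \row_i f i x).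
  by move=> a x y; apply/rowP => i; rewrite !mxE lf.
exists (fun r : 'rV_n => \sum_i r 0 i *: b i).
  by move=> x; rewrite [RHS]bE; apply: eq_bigr => i _; rewrite mxE.
move=> r; apply/rowP => j; rewrite mxE (lin_bigsum (g := f j : U -> k^o)) //.
rewrite (bigD1 j) //= big1; last first.
  move=> i /negPf ij; rewrite (linZ (g := f j : U -> k^o)) // fb eq_sym ij.
  exact: mulr0.
by rewrite (linZ (g := f j : U -> k^o)) // fb eqxx addr0; apply: mulr1.
Qed.

Definition vect_of_basis : vectType k := HB.pack U (Lmodule_hasFinDim.Build k U
    basis_axiom).

Lemma dim_vect_of_basis : \dim (fullv : {vspace vect_of_basis}) = n.
Proof. by rewrite dimvf. Qed.

Lemma basis_sum (W : lmodType k) (g : U -> W) x : linear g ->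
  g x = \sum_i f i x *: g (b i).
Proof.
case: bf => _ bE lg; rewrite {1}(bE x) (lin_bigsum (g := g)) //.
by apply: eq_bigr => i _; rewrite (linZ (g := g)).
Qed.

Lemma has_dim_basis : has_dim [set: U] n.
Proof.
case: (bf) => -[lf fb] bE; exists b; split=> [c c0 i|v]; last first.
  by split=> // _; exists (f^~ v).
have := congr1 (f i : U -> k^o) c0; rewrite (lin0 (lf i)) (lin_bigsum _ _ _ (lf i)).
rewrite (bigD1 i) //= big1.
  by rewrite addr0 (linZ (g := f i : U -> k^o)) // fb eqxx => <-; rewrite [RHS]mulr1.
move=> j /negPf ji; rewrite (linZ (g := f i : U -> k^o)) // fb eq_sym ji.
exact: mulr0.
Qed.
End VectOfBasis.

Section Assembly.
Variables (k : fieldType) (H : hopfAlgType k) (R : (H ⊗ H)%type).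
Hypothesis atR : almost_triangular R.
Variable V : ydModType H.
Hypothesis irr : yd_irreducible V.
Variables (d : nat) (hb : 'I_d -> H) (hf : 'I_d -> H -> k).
Hypothesis hB : basis hb hf.
Variables (n : nat) (vb : 'I_n -> V) (vf : 'I_n -> V -> k).
Hypothesis vB : basis vb vf.
Local Notation S := (antipode : H -> H).
Local Notation D := (comul : H -> (H ⊗ H)%type).
Local Notation e := (counit : H -> k).

Let qt : quasi_triangular R := atR.1.
Let VV : vectType k := vect_of_basis vB.
Let hfl i : linear (hf i : H -> k^o). Proof. by case: hB => -[]. Qed.

Fact transmuted_vspace : {E : {vspace 'End(VV)} |
  forall phi, phi \in E <-> transmuted R (phi : V -> V)}.
Proof.
apply: vspace_comprehension => [|a x y Ex Ey].
  have -> : ((0 : 'End(VV)) : V -> V) = (fun=> 0).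
    by apply/funext => v; rewrite zero_lfunE.
  exact: transmuted0.
have -> : ((a *: x + y : 'End(VV)) : V -> V) = (fun v => a *: (x v : V) + y v).
  by apply/funext => v; rewrite add_lfunE scale_lfunE.
exact: transmuted_lin.
Qed.
Let E := sval transmuted_vspace.
Let EP phi : phi \in E <-> transmuted R (phi : V -> V) := svalP transmuted_vspace phi.

Definition opE (phi : V -> V) (lp : linear phi) : subvs_of E :=
  vsproj E (mkHom (U := VV) (W := VV) lp).

Lemma opEE phi (lp : linear phi) v : transmuted R phi -> vsval (opE lp) v = phi v.
Proof.
move=> tp; rewrite vsprojK ?mkHomE //; apply/EP.
have -> : (mkHom (U := VV) (W := VV) lp : V -> V) = phi; last by [].
by apply/funext => w; rewrite mkHomE.
Qed.

Lemma subvs_transmuted (x : subvs_of E) : transmuted R (vsval x : V -> V).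
Proof. exact/EP/subvsP. Qed.

Lemma subvs_ext (x y : subvs_of E) : (forall v : V, vsval x v = vsval y v) -> x = y.
Proof. by move=> xy; apply: (can_inj vsvalK); apply/lfunP. Qed.

Lemma subvs_lin (x : subvs_of E) : linear (vsval x : V -> V).
Proof. by move=> a u v; apply: (linearP (vsval x)). Qed.

Lemma comp_linear (x y : subvs_of E) : linear (fun v : V => vsval x (vsval y v) : V).
Proof. exact: (lin_comp2 (subvs_lin x) (subvs_lin y)). Qed.

Let mulE (x y : subvs_of E) := opE (comp_linear x y).
Let oneE : subvs_of E := opE (@lin_id _ V).

Let mulEE x y v : vsval (mulE x y) v = vsval x (vsval y v).
Proof. by rewrite opEE //; apply: transmuted_comp => //; apply: subvs_transmuted. Qed.
Let oneEE v : vsval oneE v = v.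
Proof. by rewrite opEE //; apply: transmuted_id. Qed.

Let valE a (x y : subvs_of E) v :
  vsval (a *: x + y) v = a *: (vsval x v) + vsval y v.
Proof. by rewrite linearP add_lfunE scale_lfunE. Qed.

Let mulEl b : linear (mulE^~ b).
Proof. by move=> a x y; apply: subvs_ext => v; rewrite valE !mulEE valE. Qed.
Let mulEr b : linear (mulE b).
Proof. by move=> a x y; apply: subvs_ext => v; rewrite valE !mulEE valE linearP. Qed.
Let mulEA : associative mulE.
Proof. by move=> x y z; apply: subvs_ext => v; rewrite !mulEE. Qed.
Let mul1E : left_id oneE mulE.
Proof. by move=> x; apply: subvs_ext => v; rewrite mulEE oneEE. Qed.
Let mulE1 : right_id oneE mulE.
Proof. by move=> x; apply: subvs_ext => v; rewrite mulEE oneEE. Qed.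

Let eactV (x : subvs_of E) (v : VV) : VV := vsval x v.
Fact eactVl v : linear (eactV^~ v).
Proof. by move=> a x y; apply: valE. Qed.
Fact eactVr x : linear (eactV x).
Proof. exact: linearP. Qed.
Definition Vmod : algmod mulE oneE := @AlgMod _ _ mulE oneE VV eactV eactVl eactVr oneEE
    mulEE.

Lemma moddim_Vmod : moddim Vmod = n.
Proof. exact: dim_vect_of_basis. Qed.

Lemma moddim_Vmod_gt0 : (0 < moddim Vmod)%N.
Proof.
rewrite moddim_Vmod lt0n; apply/eqP => n0; case: irr => -[v /eqP vn0] _; apply: vn0.
case: vB => _ vE; rewrite (vE v) big1 // => -[i lti] _; exfalso.
by move: lti; rewrite n0.
Qed.

Let adlin h (x : subvs_of E) : linear (adop h (vsval x : V -> V)) :=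
  (adop_bil (subvs_lin x)).2 h.
Let adE h (x : subvs_of E) : subvs_of E := opE (adlin h x).
Let adEE h x v : vsval (adE h x) v = adop h (vsval x : V -> V) v.
Proof. by rewrite opEE //; apply: transmuted_adop => //; apply: subvs_transmuted. Qed.

Lemma adE_linearl x : linear (adE^~ x).
Proof.
move=> a h h'; apply: subvs_ext => v; rewrite valE !adEE.
exact: (adop_bil (subvs_lin x)).1.
Qed.
Lemma adop_lin_op h a (phi psi : V -> V) v :
  adop h (fun x => a *: phi x + psi x) v = a *: adop h phi v + adop h psi v.
Proof.
rewrite /adop (lin_of_sw (g := fun x : V => a *: x)); last by lin.
rewrite /sw -big_split; apply: eq_bigr => p _ /=.
by rewrite linearPr.
Qed.
Lemma adE_linearr h : linear (adE h).
Proof.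
move=> a x y; apply: subvs_ext => v; rewrite valE !adEE -adop_lin_op.
by congr (adop h _ v); apply/funext => w; apply: valE.
Qed.

(** The multiplicative matrix of the basis: Δ(h_i) = Σ_j G_ij ⊗ h_j, hence
    Δ(G_ij) = Σ_l G_il ⊗ G_lj. *)
Let G i j : H := \sw_(a, b <- D (hb i)) hf j b *: a.

Lemma sw_G (X : lmodType k) i (F : H -> H -> X) : bil F ->
  sw (D (hb i)) F = \sum_l F (G i l) (hb l).
Proof.
move=> bF; transitivity (\sw_(a, b <- D (hb i)) \sum_l hf l b *: F a (hb l)).
  by apply: eq_sw => a b; rewrite -(basis_sum hB (g := F a)) //; apply: bF.2.
rewrite /sw exchange_big /=; apply: eq_bigr => l _.
rewrite /G (lin_of_sw (g := fun t => F t (hb l))); last exact: bF.1.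
by apply: eq_bigr => p _; rewrite (linZ (g := fun t => F t (hb l))) //; apply: bF.1.
Qed.

Lemma counit_G i j : e (G i j) = (i == j)%:R.
Proof.
have le : linear (e : H -> k^o) by move=> a x y; apply: linearP.
rewrite /G (lin_of_sw _ _ le).
have h := counit_l (hb i) (hfl j); have [[_ fb] _] := hB.
rewrite fb eq_sym in h; rewrite -h; apply: eq_bigr => p _.
by rewrite (linZ _ _ le) /GRing.scale /= mulrC.
Qed.

(** The coefficients G_ij span H. *)
Lemma hb_G i : hb i = \sum_j e (hb j) *: G i j.
Proof.
rewrite -[LHS](counit_r (hb i) (F := id)); last by lin.
by rewrite (@sw_G _ i (fun a b => e b *: a)) //; lin.
Qed.

Lemma comul_G (X : lmodType k) i j (F : H -> H -> X) : bil F ->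
  sw (D (G i j)) F = \sum_l F (G i l) (G l j).
Proof.
move=> bF; rewrite {1}/G (lin_of_sw (g := fun x => sw (D x) F)); last by lin.
have lj := hfl j.
transitivity (\sw_(a, b <- D (hb i)) \sw_(a1, a2 <- D a) hf j b *: F a1 a2).
  apply: eq_sw => a b; rewrite linearZ /= (linZ (g := fun t => sw t F)); last exact:
      sw_linear.
  by rewrite (lin_of_sw (g := fun x : X => hf j b *: x)) //; lin.
rewrite -(coassoc (hb i) (F := fun a1 a2 b => hf j b *: F a1 a2)); last first.
  by split=> [p q|p q|p q]; [lin|lin|apply: lin_scalel].
rewrite (@sw_G _ i (fun a w => \sw_(c, b <- D w) hf j b *: F a c)); last first.
  split=> [w|a]; first by lin.
  apply: lin_sw_arg; first by lin.
  by split=> [q|p]; [lin|apply: lin_scalel].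
apply: eq_bigr => l _; rewrite /G (lin_of_sw (g := F (\sw_(a, b <- D (hb i)) hf l b *:
    a))); last exact: bF.2.
by apply: eq_bigr => p _; rewrite (linZ _ _ (bF.2 _)).
Qed.

Let tc i j (x : subvs_of E) := adE (G i j) x.
Fact tc_linear i j : linear (tc i j). Proof. exact: adE_linearr. Qed.
Fact tc1 i j : tc i j oneE = (i == j)%:R *: oneE.
Proof.
apply: subvs_ext => v; rewrite adEE.
have -> : (vsval oneE : V -> V) = id by apply/funext => w; apply: oneEE.
rewrite adop_id counit_G.
have -> : vsval ((i == j)%:R *: oneE) = (i == j)%:R *: vsval oneE by exact: linearZ.
by rewrite scale_lfunE oneEE.
Qed.

Let val_sum I (r : seq I) (F : I -> subvs_of E) v :
  vsval (\sum_(i <- r) F i) v = \sum_(i <- r) vsval (F i) v.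
Proof. by rewrite linear_sum sum_lfunE. Qed.

Fact tcM i j a b : tc i j (mulE a b) = \sum_l mulE (tc i l a) (tc l j b).
Proof.
apply: subvs_ext => v; rewrite adEE val_sum.
have -> : (vsval (mulE a b) : V -> V) = (fun w => vsval a (vsval b w)).
  by apply/funext => w; apply: mulEE.
have la := subvs_lin a; have lb := subvs_lin b.
rewrite (adop_comp (G i j) v la lb).
have bF : bil (fun x y => adop x (vsval a : V -> V) (adop y (vsval b : V -> V) v)).
  have ba := adop_bil la; have bb := adop_bil lb.
  by lin.
by rewrite (comul_G i j bF); apply: eq_bigr => l _; rewrite mulEE !adEE.
Qed.

Let tp i j (v : VV) : VV := act (G i j) (v : V).
Let ti i j (v : VV) : VV := act (antipode_inv R (G i j)) (v : V).
Fact tp_linear i j : linear (tp i j).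
Proof. by move=> a u v; rewrite /tp; apply: linearPr. Qed.
Fact ti_linear i j : linear (ti i j).
Proof. by move=> a u v; rewrite /ti; apply: linearPr. Qed.
Fact tpE i j (x : subvs_of E) (v : Vmod) : tp i j (eact x v) = \sum_l eact (tc i l x) (tp
    l j v : Vmod).
Proof.
have lx := subvs_lin x.
transitivity (\sw_(a, b <- D (G i j)) adop a (vsval x : V -> V) (act b (v : V))).
  exact: (act_adop (G i j) v lx).
have ba := adop_bil lx.
rewrite (comul_G i j (F := fun a b => adop a (vsval x : V -> V) (act b (v : V)))); last
    by lin.
by apply: eq_bigr => l _; rewrite /= /eactV adEE.
Qed.
Fact tpK j l (v : Vmod) : \sum_i tp i j (ti l i v) = (j == l)%:R *: v.
Proof.
have ls := @antipode_inv_linear k H R.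
have h := antipode_inv_l qt (G l j) (F := fun t => act t (v : V)).
rewrite counit_G act1 eq_sym in h; rewrite -h; last by lin.
have bF : bil (fun a b => act (b * antipode_inv R a) (v : V)) by lin.
rewrite (comul_G l j bF); apply: eq_bigr => i _.
exact: (esym (actM (G i j) (antipode_inv R (G l i)) (v : V))).
Qed.

Definition Vtwist : twist Vmod :=
  @Twist _ _ mulE oneE Vmod d tc tp ti tc_linear tc1 tcM tp_linear ti_linear tpE tpK.

Lemma sw_coactR_basis (X : lmodType k) v (F : H -> V -> X) : bil F ->
  sw (coactR R v) F = \sum_i F (hb i) (coefop R (hf i) v).
Proof.
move=> bF; transitivity (\sw_(t, v0 <- coactR R v) \sum_i hf i t *: F (hb i) v0).
  by apply: eq_sw => t v0; rewrite -(basis_sum hB (g := fun t => F t v0)) //; apply: bF.1.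
rewrite /sw exchange_big /=; apply: eq_bigr => i _.
rewrite /coefop (lin_of_sw (g := F (hb i))); last exact: bF.2.
by apply: eq_bigr => p _; rewrite (linZ _ _ (bF.2 _)).
Qed.

(** coact_of_coactR expresses the coaction through H and the operators of E. *)
Lemma yd_submod_criterion (W : set V) : subspace W ->
  (forall h v, W v -> W (act h v)) ->
  (forall f v, linear (f : H -> k^o) -> W v -> W (coefop R f v)) -> yd_submod W.
Proof.
move=> sW aW eW; split=> // v Wv.
rewrite -[coact v]sw_id -(coact_of_coactR qt v); last by lin.
rewrite sw_coactR_basis; last by lin.
apply: tensor_of_sum => i _; apply: tensor_of_sw => r s; apply: tensor_of_pure => //.
exact/aW/eW.
Qed.

(** The largest H-stable subspace W of the kernel of g is also E-stable, so it is 0;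
    and x maps V into W. *)
Lemma Vmod_faithful (M : algmod mulE oneE) (g : 'Hom(Vmod, M)) (x : subvs_of E) :
  equivariant g -> g != 0 ->
  (forall i j (y : M), eact (@tcoef _ _ _ _ _ Vtwist i j x) y = 0) -> x = 0.
Proof.
move=> Hg gn0 kill.
have lg : linear (g : V -> M) by move=> a u v; apply: linearP.
pose W : set V := [set v | forall h, g (act h v : Vmod) = 0].
have eactZl := @eact_scale _ _ mulE oneE M.
have step (h : H) (y : subvs_of E) (v : V) :
    g (act h (vsval y v) : Vmod) = \sw_(a, b <- D h) eact (adE a y) (g (act b v : Vmod)).
  rewrite (act_adop h v (subvs_lin y)) (lin_of_sw (g := (g : V -> M))) //.
  apply: eq_sw => a b; rewrite -Hg; congr (g _).
  by rewrite /= /eactV adEE.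
have kill' h (y : M) : eact (adE h x) y = 0.
  have lad : linear (fun h => eact (adE h x) y).
    exact: (lin_comp2 (eactl y) (adE_linearl x)).
  rewrite (basis_sum hB h lad) big1 // => i _.
  rewrite hb_G (lin_bigsum _ _ _ lad) big1 ?scaler0 // => j _.
  by rewrite (linZ _ _ lad); have := kill i j y; rewrite /= /tc => ->; rewrite scaler0.
have sW : subspace W.
  split; first by move=> h; rewrite linear0r (lin0 lg).
  by move=> a u v Wu Wv h; rewrite linearPr lg Wu Wv scaler0 addr0.
have yW : yd_submod W.
  apply: yd_submod_criterion => //.
    by move=> h v Wv h'; rewrite -actM.
  move=> f v lf Wv h.
  have Ef : transmuted R (coefop R f : V -> V) by exists f.
  have lE := coefop_linear R (V := V) lf.
  have := step h (opE lE) v; rewrite opEE // => ->.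
  by rewrite /sw big1 // => p _; rewrite Wv eact0.
case: irr => _ /(_ W yW) [W0|WT].
  apply: subvs_ext => v.
  have : W (vsval x v).
    by move=> h; rewrite step /sw big1 // => p _; rewrite kill'.
  by rewrite W0 => ->; rewrite linear0 zero_lfunE.
move/eqP: gn0; case; apply/lfunP => v; rewrite zero_lfunE.
have : W v by rewrite WT.
by move=> /(_ 1); rewrite act1.
Qed.

Let rE (x : subvs_of E) (v : VV) : VV := ract R (vsval x : V -> V) (v : V).
Fact rEl v : linear (rE^~ v).
Proof.
move=> a x y; rewrite /rE /ract (lin_of_sw (g := fun x : V => a *: x)); last by lin.
rewrite /sw -big_split; apply: eq_bigr => p _ /=.
rewrite -adop_lin_op; congr (adop _ _ _); apply/funext => w; exact: valE.
Qed.
Fact rEr x : linear (rE x).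
Proof.
have lx := subvs_lin x.
change (linear (fun v : V => \sw_(r, s <- R) adop s (vsval x : V -> V) (act r v))).
by lin.
Qed.
Fact rE1 v : rE oneE v = v.
Proof.
rewrite /rE; have -> : (vsval oneE : V -> V) = id by apply/funext => w; apply: oneEE.
exact: (ract_id qt).
Qed.
Fact rEM a b v : rE (mulE a b) v = rE b (rE a v).
Proof.
rewrite /rE -(ract_comp qt atR.2 v (subvs_transmuted a) (subvs_transmuted b)).
by congr (ract R _ v); apply/funext => w; apply: mulEE.
Qed.
Fact rEC a b (v : Vmod) : eact a (rE b v : Vmod) = rE b (eact a v).
Proof. exact: (ract_comm qt atR.2 v (subvs_transmuted a) (subvs_transmuted b)). Qed.

Theorem dimE_dvd : (\dim E %| n)%N.
Proof.
have := algebra_dim_dvd mulEl mulEr mulEA mul1E mulE1 moddim_Vmod_gt0 Vmod_faithful rEl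
    rEr rE1 rEM rEC.
by rewrite moddim_Vmod dimvf.
Qed.

Let m := \dim E.
Let eb (i : 'I_m) : 'End(VV) := (vbasis E)`_i.
Let coefL (f : H -> k) (lf : linear (f : H -> k^o)) : 'End(VV) :=
  mkHom (U := VV) (W := VV) (coefop_linear R (V := V) lf).
Let coefLE (f : H -> k) (lf : linear (f : H -> k^o)) v : coefL lf v = coefop R f (v : V).
Proof. exact: mkHomE. Qed.
Let coefL_E (f : H -> k) (lf : linear (f : H -> k^o)) : coefL lf \in E.
Proof. by apply/EP; exists f => //; apply/funext => v; apply: coefLE. Qed.

(** The elements with ρ_R(v) = Σ_i dd_i ⊗ eb_i(v), for eb a basis of E. *)
Let dd (i : 'I_m) : H := \sum_j coord (vbasis E) i (coefL (hfl j)) *: hb j.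

(** Evaluation at dd_i is the i-th coordinate of E. *)
Lemma coord_coefL (f : H -> k) (lf : linear (f : H -> k^o)) i :
  coord (vbasis E) i (coefL lf) = f (dd i).
Proof.
have -> : coefL lf = \sum_j f (hb j) *: coefL (hfl j).
  apply/lfunP => v; rewrite sum_lfunE coefLE.
  transitivity (\sw_(t, v0 <- coactR R (v : V)) \sum_j (hf j t * f (hb j)) *: v0).
    apply: eq_sw => t v0; rewrite -scaler_suml; congr (_ *: _).
    exact: (basis_sum hB t lf).
  rewrite /sw exchange_big /=; apply: eq_bigr => j _.
  rewrite scale_lfunE coefLE /coefop (lin_of_sw (g := fun x : V => f (hb j) *: x)); last
      by lin.
  by apply: eq_bigr => p _; rewrite scalerA mulrC.
rewrite linear_sum /dd (lin_bigsum _ _ _ lf); apply: eq_bigr => j _.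
by rewrite linearZ (linZ _ _ lf) /GRing.scale /= mulrC.
Qed.

Lemma coefop_dd (f : H -> k) v : linear (f : H -> k^o) ->
  coefop R f v = \sum_i f (dd i) *: (eb i (v : VV) : V).
Proof.
move=> lf; rewrite -(coefLE lf) {1}(coord_vbasis (coefL_E lf)) sum_lfunE.
by apply: eq_bigr => i _; rewrite scale_lfunE coord_coefL.
Qed.

Fact dd_dual : exists f : 'I_m -> H -> k, (forall i, linear (f i : H -> k^o)) /\
  forall i j, f i (dd j) = (i == j)%:R.
Proof.
have ex i : exists f : H -> k, linear (f : H -> k^o) /\ forall j, f (dd j) = (i == j)%:R.
  have [f lf fE] : transmuted R (eb i : V -> V).
    by apply/EP; rewrite /eb vbasis_mem // mem_nth // size_tuple.
  exists f; split=> // j; rewrite -(coord_coefL lf).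
  have -> : coefL lf = eb i by apply/lfunP => v; rewrite coefLE -fE.
  by rewrite /eb coord_free ?(basis_free (vbasisP E)) // eq_sym.
have [f fP] := choice ex; exists f; split=> [i|i j]; by have [] := fP i.
Qed.

Lemma sw_coactR_dd (X : lmodType k) v (F : H -> V -> X) : bil F ->
  sw (coactR R v) F = \sum_i F (dd i) (eb i (v : VV)).
Proof.
move=> bF; rewrite sw_coactR_basis //.
transitivity (\sum_j \sum_i hf j (dd i) *: F (hb j) (eb i (v : VV))).
  apply: eq_bigr => j _; rewrite (coefop_dd v (hfl j)) (lin_bigsum _ _ _ (bF.2 _)).
  by apply: eq_bigr => i _; rewrite (linZ _ _ (bF.2 _)).
rewrite exchange_big /=; apply: eq_bigr => i _.
by rewrite -(basis_sum hB (g := fun t => F t (eb i (v : VV)))) //; apply: bF.1.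
Qed.

(** The dd_i are a basis of D_V.  Their span is a subcoalgebra because a functional
    on H_R acts on V only through its values at the dd_i, so projecting both legs
    of Δ_R(dd_l) onto the span changes no coefficient.  It is contained in any
    subcoalgebra D' through which ρ_R factors: a functional vanishing on D' but not
    at dd_i would give the zero operator, with i-th coordinate nonzero. *)
Lemma has_dim_D : has_dim (D_ V R) m.
Proof.
have [ff [lff ffd]] := dd_dual.
pose DD : set H := [set x | exists c : 'I_m -> k, x = \sum_i c i *: dd i].
have sDD : subspace DD.
  split; first by exists (fun=> 0); rewrite big1 // => i _; rewrite scale0r.
  move=> a _ _ [c ->] [c' ->]; exists (fun i => a * c i + c' i).
  rewrite scaler_sumr -big_split; apply: eq_bigr => i _.
  by rewrite scalerDl scalerA.
have DDd i : DD (dd i).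
  exists (fun j => (i == j)%:R); rewrite (bigD1 i) //= eqxx scale1r big1 ?addr0 // => j.
  by rewrite eq_sym => /negPf ->; rewrite scale0r.
pose proj x := \sum_i ff i x *: dd i.
have lproj : linear proj.
  move=> a x y; rewrite /proj scaler_sumr -big_split; apply: eq_bigr => i _.
  by rewrite lff scalerDl scalerA.
have DDproj x : DD (proj x) by exists (ff^~ x).
have projd i : proj (dd i) = dd i.
  rewrite /proj (bigD1 i) //= ffd eqxx scale1r big1 ?addr0 // => j /negPf ji.
  by rewrite ffd ji scale0r.
have bilf (f g : H -> k) : linear (f : H -> k^o) -> linear (g : H -> k^o) ->
    bil (fun a b : H => (f a * g b : k^o)).
  move=> lf lg; split=> [w a x y|u a x y].
    by rewrite lf mulrDl -mulrA.
  by rewrite lg mulrDr mulrCA.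
have lconv (f g : H -> k) : linear (f : H -> k^o) -> linear (g : H -> k^o) ->
    linear (fun x => \sw_(a, b <- comulR R x) (f a * g b : k^o)).
  move=> lf lg; apply: lin_sw_arg; last exact: bilf.
  exact: comulR_linear.
have expand (p : H -> H) (X : lmodType k) (t : (H ⊗ H)%type) (F : H -> H -> X) : bil F ->
    \sw_(a, b <- t) F (p a) (p b) =
    \sum_i \sum_j (\sw_(a, b <- t) (hf i (p a) * hf j (p b) : k^o)) *: F (hb i) (hb j).
  move=> bF; transitivity (\sw_(a, b <- t) \sum_i \sum_j (hf i (p a) * hf j (p b)) *: F
      (hb i) (hb j)).
    apply: eq_sw => a b; rewrite (basis_sum hB (g := fun a => F a (p b))); last exact: bF.1.
    apply: eq_bigr => i _; rewrite (basis_sum hB (g := F _)); last exact: bF.2.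
    by rewrite scaler_sumr; apply: eq_bigr => j _; rewrite scalerA.
  rewrite /sw exchange_big /=; apply: eq_bigr => i _.
  rewrite exchange_big /=; apply: eq_bigr => j _.
  by rewrite scaler_suml.
have coefop_proj (f : H -> k) (v : V) : linear (f : H -> k^o) ->
    coefop R f v = coefop R (fun x => f (proj x)) v.
  move=> lf; rewrite (coefop_dd v lf) (coefop_dd v (lin_comp2 lf lproj)).
  by apply: eq_bigr => i _; rewrite projd.
have conv_proj (f g : H -> k) l : linear (f : H -> k^o) -> linear (g : H -> k^o) ->
    \sw_(a, b <- comulR R (dd l)) (f a * g b : k^o) =
    \sw_(a, b <- comulR R (dd l)) (f (proj a) * g (proj b) : k^o).
  move=> lf lg; have lfp := lin_comp2 lf lproj; have lgp := lin_comp2 lg lproj.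
  refine (etrans (esym (coord_coefL (lconv _ _ lf lg) l)) _).
  refine (etrans _ (coord_coefL (lconv _ _ lfp lgp) l)).
  congr (coord _ _ _); apply/lfunP => v; rewrite !coefLE.
  rewrite -(coefop_comp qt v lg lf) -(coefop_comp qt v lgp lfp).
  by rewrite -(coefop_proj f) // -(coefop_proj g).
pose rr x := \sw_(a, b <- comulR R x) proj a ⊗ proj b.
have lc : linear (comulR R) by exact: comulR_linear.
have lr : linear rr by apply: lin_sw_arg; [exact: comulR_linear|lin].
have comul_proj x : DD x -> comulR R x = rr x.
  move=> [c ->]; rewrite (lin_bigsum _ _ _ lc) (lin_bigsum _ _ _ lr).
  apply: eq_bigr => l _; rewrite (linZ _ _ lc) (linZ _ _ lr); congr (_ *: _).
  rewrite -[LHS]sw_id (expand id); last by lin.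
  rewrite /rr (expand proj _ _ (fun a b => a ⊗ b)); last by lin.
  by apply: eq_bigr => i _; apply: eq_bigr => j _; rewrite conv_proj.
have DE : D_ V R = DD.
  apply/seteqP; split=> [x Dx|x [c ->] D' [[sD' _] cD']].
    apply: Dx; split; first split=> // y /comul_proj ->.
      by apply: tensor_of_sw => a b; apply: tensor_of_pure.
    move=> v; rewrite -[coactR R v]sw_id sw_coactR_dd; last by lin.
    by apply: tensor_of_sum => i _; apply: tensor_of_pure.
  apply: subspace_sum => // i _; apply: subspaceZ => //.
  apply: contrapT => nD; have [f [lf f0 f1]] := separation sD' nD.
  have : coefL lf = 0.
    apply/lfunP => v; rewrite coefLE zero_lfunE /coefop.
    have [s sD ->] := cD' v.
    have bf : bil (fun t v0 => f t *: (v0 : V)).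
      by split=> [w|u]; [apply: lin_scalel|lin].
    rewrite (sw_sum _ _ _ bf) big_seq big1 // => p /sD[Dp _].
    by rewrite sw_tens // f0 // scale0r.
  move=> e0; have := coord_coefL lf i; rewrite e0 linear0 f1 => /esym/eqP.
  by rewrite oner_eq0.
rewrite DE; exists dd; split=> [c c0 i|//].
have := congr1 (ff i) c0; rewrite (lin0 (lff i)) (lin_bigsum _ _ _ (lff i)).
rewrite (bigD1 i) //= big1.
  by rewrite addr0 (linZ _ _ (lff i)) ffd eqxx => <-; rewrite [RHS]mulr1.
move=> j /negPf ji; rewrite (linZ _ _ (lff i)) ffd eq_sym ji.
exact: mulr0.
Qed.
End Assembly.

Theorem corollary4p10 (k : fieldType) (char0 : [pchar k] =i pred0)
    (H : hopfAlgType k) (R : H ⊗ H)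
    (ssH : semisimple_alg H) (atR : almost_triangular R)
    (V : ydModType H) (irrV : yd_irreducible V) :
  exists d n : nat,
    [/\ has_dim (D_ V R) d, has_dim [set: V] n & (d %| n)%N].
Proof.
have fH := hopf_findim atR.1 ssH.
have [n [vb [vf vB]]] := yd_findim fH irrV.
have [d [hb [hf hB]]] := fH.
exists (\dim (sval (transmuted_vspace R vB))), n; split.
- exact: (has_dim_D atR hB vB).
- exact: (has_dim_basis vB).
- exact: (dimE_dvd atR irrV hB vB).
Qed.
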